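(* Fix three non-collinear points $z_1,z_2,z_3\in\mathbb C$ and consider configurations $\mathbf z=(z_4,\dots,z_{N+3})$ of points in the open triangle with vertices $z_1,z_2,z_3$, such that $z_1,\dots,z_{N+3}$ are pairwise distinct. For configurations where the Delaunay triangulation $T=T(\mathbf z)$ of $\{z_1,\dots,z_{N+3}\}$ is unique, define $\mathcal A_T(\mathbf z)=-\sum_{f}\mathrm{Vol}(f)$, the sum over the (counterclockwise oriented) triangles $f$ of $T$, and $D_{u\bar v}(\mathbf z)=\frac{\partial^2}{\partial z_u\partial\bar z_v}\mathcal A_T(\mathbf z)$ for $u,v\in\{4,\dots,N+3\}$. Then the Hermitian form $D$ is positive, i.e. $\sum_{u,v}\xi_uD_{u\bar v}\bar\xi_v\ge0$ for all $\xi\in\mathbb C^N$, and $D$ extends continuously to all configurations of pairwise distinct points (in particular across edge flips of the Delaunay triangulation); thus $D$ is a continuous Kähler form with prepotential $\mathcal A_T$.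
   Context: For a triangle $f=(z_a,z_b,z_c)$ listed counterclockwise, $\mathrm{Vol}(f)=\mathrm{Im}\,\mathrm{Li}_2(w)+\ln|w|\,\mathrm{Arg}(1-w)$ with $w=\frac{z_c-z_a}{z_b-z_a}$ (Bloch–Wigner function); it is the hyperbolic volume of the ideal tetrahedron with vertices $z_a,z_b,z_c,\infty$ in the upper half-space model of $\mathbb H_3$, and equals $Л(\alpha_1)+Л(\alpha_2)+Л(\alpha_3)$ with $Л(\alpha)=-\int_0^\alpha\log(2\sin t)\,dt$ and $\alpha_i$ the angles of $f$. $\partial/\partial z$, $\partial/\partial\bar z$ are Wirtinger derivatives. *)

(* Defs.v *)
From Stdlib Require Import Reals List.
From Coquelicot Require Import Coquelicot.
Import ListNotations.
Open Scope R_scope.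

Notation CC := Complex.C.

Definition carg (w : CC) : R :=
  let x := fst w in let y := snd w in
  if Rlt_dec 0 x then atan (y / x)
  else if Rlt_dec x 0 then (if Rle_dec 0 y then atan (y / x) + PI else atan (y / x) - PI)
  else if Rlt_dec 0 y then PI / 2
  else if Rlt_dec y 0 then - (PI / 2) else 0.

(* Im Li2(w), for w not in [1,+oo), via the standard integral representation
   Li2(w) = - int_0^1 Log(1 - w t) / t dt  (principal Log), so that
   Im Li2(w) = - int_0^1 Arg(1 - w t) / t dt. *)
Definition ImLi2 (w : CC) : R :=
  - RInt (fun t : R => carg (Cminus 1 (Cmult (RtoC t) w)) / t) 0 1.

Definition BlochWigner (w : CC) : R :=
  ImLi2 w + ln (Cmod w) * carg (Cminus 1 w).

Definition Vol (za zb zc : CC) : R :=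
  BlochWigner (Cdiv (Cminus zc za) (Cminus zb za)).

(* twice the signed area of (a,b,c); > 0 iff counterclockwise *)
Definition orient (a b c : CC) : R :=
  (fst b - fst a) * (snd c - snd a) - (snd b - snd a) * (fst c - fst a).

(* open / closed triangle with vertices a b c (any orientation, nondegenerate) *)
Definition in_open_tri (a b c p : CC) : Prop :=
  0 < orient a b p * orient a b c /\
  0 < orient b c p * orient b c a /\
  0 < orient c a p * orient c a b.

Definition in_closed_tri (a b c p : CC) : Prop :=
  0 <= orient a b p * orient a b c /\
  0 <= orient b c p * orient b c a /\
  0 <= orient c a p * orient c a b.

(* the full point list P_1..P_{N+3}: fixed vertices z1 z2 z3, and z_k (k >= 4)
   taken from the configuration z : nat -> CC (only 4 <= k <= N+3 matter) *)
Definition pts (z1 z2 z3 : CC) (z : nat -> CC) (k : nat) : CC :=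
  match k with 1 => z1 | 2 => z2 | 3 => z3 | _ => z k end.

Definition idx (N k : nat) : Prop := (1 <= k <= N + 3)%nat.
Definition cidx (N k : nat) : Prop := (4 <= k <= N + 3)%nat.

Definition admissible (N : nat) (z1 z2 z3 : CC) (z : nat -> CC) : Prop :=
  (forall k, cidx N k -> in_open_tri z1 z2 z3 (z k)) /\
  (forall j k, idx N j -> idx N k -> j <> k ->
     pts z1 z2 z3 z j <> pts z1 z2 z3 z k).

Definition tri := (nat * nat * nat)%type.

Definition tP (P : nat -> CC) (t : tri) : CC * CC * CC :=
  let '(a, b, c) := t in (P a, P b, P c).

Definition t_has_vertex (t : tri) (k : nat) : Prop :=
  let '(a, b, c) := t in k = a \/ k = b \/ k = c.

Definition t_closed (P : nat -> CC) (t : tri) (p : CC) : Prop :=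
  let '(a, b, c) := t in
  0 <= orient (P a) (P b) p /\ 0 <= orient (P b) (P c) p /\ 0 <= orient (P c) (P a) p.

Definition t_open (P : nat -> CC) (t : tri) (p : CC) : Prop :=
  let '(a, b, c) := t in
  0 < orient (P a) (P b) p /\ 0 < orient (P b) (P c) p /\ 0 < orient (P c) (P a) p.

(* T is a triangulation of {P_1..P_{N+3}} (whose convex hull is the triangle
   z1 z2 z3), with every triangle listed counterclockwise. *)
Definition is_triangulation (N : nat) (z1 z2 z3 : CC) (z : nat -> CC)
    (T : list tri) : Prop :=
  let P := pts z1 z2 z3 z in
  (forall t, In t T -> let '(a, b, c) := t in
      idx N a /\ idx N b /\ idx N c /\ 0 < orient (P a) (P b) (P c)) /\
  (forall i j t s, nth_error T i = Some t -> nth_error T j = Some s -> i <> j ->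
      forall p, ~ (t_open P t p /\ t_open P s p)) /\
  (forall p, in_closed_tri z1 z2 z3 p <-> exists t, In t T /\ t_closed P t p) /\
  (forall k, idx N k -> exists t, In t T /\ t_has_vertex t k) /\
  (forall t k, In t T -> idx N k -> t_closed P t (P k) -> t_has_vertex t k).

Definition is_delaunay (N : nat) (z1 z2 z3 : CC) (z : nat -> CC)
    (T : list tri) : Prop :=
  is_triangulation N z1 z2 z3 z T /\
  forall t, In t T -> let '(a, b, c) := t in
    let P := pts z1 z2 z3 z in
    forall o : CC,
      Cmod (Cminus (P a) o) = Cmod (Cminus (P b) o) ->
      Cmod (Cminus (P a) o) = Cmod (Cminus (P c) o) ->
      forall k, idx N k -> Cmod (Cminus (P a) o) <= Cmod (Cminus (P k) o).

Definition same_triangles (T T' : list tri) : Prop :=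
  forall a b c : nat,
    (exists t, In t T /\ t_has_vertex t a /\ t_has_vertex t b /\ t_has_vertex t c
               /\ a <> b /\ b <> c /\ a <> c) <->
    (exists t, In t T' /\ t_has_vertex t a /\ t_has_vertex t b /\ t_has_vertex t c
               /\ a <> b /\ b <> c /\ a <> c).

Definition unique_delaunay (N : nat) (z1 z2 z3 : CC) (z : nat -> CC)
    (T : list tri) : Prop :=
  is_delaunay N z1 z2 z3 z T /\
  forall T', is_delaunay N z1 z2 z3 z T' -> same_triangles T T'.

Definition A_T (z1 z2 z3 : CC) (T : list tri) (z : nat -> CC) : R :=
  - fold_right (fun t acc => let '(a, b, c) := t in
        let P := pts z1 z2 z3 z in Vol (P a) (P b) (P c) + acc) 0 T.

Definition shift (z : nat -> CC) (u : nat) (h : CC) : nat -> CC :=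
  fun k => if Nat.eqb k u then Cplus (z k) h else z k.

Definition rpartial (u : nat) (d : bool) (F : (nat -> CC) -> R) (z : nat -> CC) : R :=
  Derive (fun s : R => F (shift z u (if d then RtoC s else Cmult (RtoC s) Ci))) 0.

Definition wirtinger2 (u v : nat) (F : (nat -> CC) -> R) (z : nat -> CC) : CC :=
  let d a b := rpartial u a (rpartial v b F) z in
  Cmult (RtoC (/ 4))
    (Cplus (RtoC (d true true + d false false))
           (Cmult Ci (RtoC (d true false - d false true)))).

Definition Dform (z1 z2 z3 : CC) (T : list tri) (z : nat -> CC) (u v : nat) : CC :=
  wirtinger2 u v (A_T z1 z2 z3 T) z.

Definition csum (lo n : nat) (f : nat -> CC) : CC :=
  fold_right (fun k acc => Cplus (f k) acc) (RtoC 0) (seq lo n).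

Definition hermitian_value (N : nat) (D : nat -> nat -> CC) (xi : nat -> CC) : CC :=
  csum 4 N (fun u => csum 4 N (fun v => Cmult (Cmult (xi u) (D u v)) (Cconj (xi v)))).

(* Main.v *)
(* The Bloch-Wigner function has dVol = ln|w| d Arg(1-w) - ln|1-w| d Arg w. Differentiating
   once more, the logarithms cancel in the complex Hessian, and a counterclockwise triangle
   f = (a, b, c) contributes to D the rank one form
     S / (2 |b-a|^2 |c-a|^2 |b-c|^2) m_u conj(m_v),   S = orient a b c > 0,
   with m_a = c - b, m_b = a - c, m_c = b - a; hence D is positive.

   Only the triangles having uv as an edge contribute to D_uv, and the contribution of the
   triangle on the left (right) of uv depends only on |u-v| and its angle alpha (beta) opposite
   to uv. The sum is - sin(alpha+beta) e^(i(alpha-beta)) / (2 |u-v|^2). By the empty circle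
   property, alpha and beta are the largest angles under which uv is seen from the points on
   its two sides, and uv is no Delaunay edge if these two maxima add up to more than PI. So D_uv
   is a function of the two maxima, vanishing when their sum is at least PI; this function makes
   sense for every configuration and is continuous, also when a point crosses the segment uv,
   because there it vanishes identically. By translation invariance D_uu is minus the sum of
   the D_uw over all the vertices w other than u, including z1, z2, z3. *)

Require Import Defs.
From Stdlib Require Import Reals List.
From Coquelicot Require Import Coquelicot.
From Stdlib Require Import Lra Lia Classical.
Import ListNotations.
Open Scope R_scope.

(** [A_T] is differentiated with T fixed, and its derivatives are explicit wherever all triangles of
    T are counterclockwise, an open condition. The geometric obstacle is to find the triangles on
    the two sides of a segment uw, and to exclude others, from the bare facts that the triangles
    cover, have disjoint interiors and contain no points but their vertices. A straight ray from u
    may run along a common edge of two triangles. It is therefore replaced by a parabolic arc that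
    leaves u towards w and bends to the left or to the right: for small positive parameter such an
    arc lies in the interior of exactly one triangle, which has u as a vertex, whether or not uw is
    an edge. Angles are represented by their cosines. Largest angles become minima of cosines,
    comparing two angles becomes a polynomial inequality, which for points on one circle is the
    incircle determinant, and a + b <= PI becomes cos a + cos b >= 0. *)

(** * The integral representation of Im Li2 *)

(** The cases of [carg] merge into one smooth formula on the open lower half-plane, where 1 - t w
    lies for Im w > 0 and t > 0. *)
Lemma carg_lower (x y : R) : y < 0 -> carg (x, y) = atan (x / - y) - PI / 2.
Proof.
intros Hy. unfold carg; simpl.
destruct (Rlt_dec 0 x) as [Hx|Hx].
- replace (y / x) with (- / (x / - y)) by (field; lra).
  rewrite atan_opp, atan_inv; [lra|].
  apply Rdiv_lt_0_compat; lra.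
- destruct (Rlt_dec x 0) as [Hx'|Hx'].
  + destruct (Rle_dec 0 y); [lra|].
    replace (y / x) with (/ ((- x) / - y)) by (field; lra).
    rewrite atan_inv by (apply Rdiv_lt_0_compat; lra).
    replace (- x / - y) with (- (x / - y)) by (field; lra).
    rewrite atan_opp. lra.
  + assert (x = 0) by lra. subst x.
    destruct (Rlt_dec 0 y); [lra|]. destruct (Rlt_dec y 0); [|lra].
    unfold Rdiv; rewrite Rmult_0_l, atan_0. lra.
Qed.

(* The three arctangents are the complements of the angles of the triangle (0, 1, w). *)
Lemma triangle_atan (x y : R) : 0 < y ->
  atan ((x * x + y * y - x) / y) = PI / 2 - (atan (x / y) + atan ((1 - x) / y)).
Proof.
intros Hy.
set (B := x / y). set (D := (1 - x) / y).
assert (HBD : 0 < B + D).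
{ unfold B, D. replace (x / y + (1 - x) / y) with (/ y) by (field; lra).
  now apply Rinv_0_lt_compat. }
pose proof (atan_bound B). pose proof (atan_bound D).
assert (- atan D < atan B).
{ rewrite <- atan_opp. apply atan_increasing. lra. }
rewrite <- (atan_tan (PI / 2 - (atan B + atan D))) by lra.
f_equal. unfold tan.
rewrite sin_shift, cos_shift, cos_plus, sin_plus, !cos_atan, !sin_atan.
assert (0 < sqrt (1 + B²)) by (apply sqrt_lt_R0; pose proof (Rle_0_sqr B); lra).
assert (0 < sqrt (1 + D²)) by (apply sqrt_lt_R0; pose proof (Rle_0_sqr D); lra).
transitivity ((1 - B * D) / (B + D)).
- unfold B, D. field. split; [lra|]. lra.
- field. repeat split; lra.
Qed.

Definition atan_quotient (u : R) : R := if Req_dec_T u 0 then 1 else atan u / u.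

Lemma continuous_atan_quotient_0 : continuous atan_quotient 0.
Proof.
unfold atan_quotient.
apply filterlim_locally. intros eps.
assert (H : derivable_pt_lim atan 0 1).
{ replace 1 with (/ (1 + 0 ^ 2)) by field.
  apply derivable_pt_lim_atan. }
destruct (H eps (cond_pos eps)) as [d Hd].
exists d. intros u Hu. change (Rabs (u + - 0) < d) in Hu.
destruct (Req_dec_T 0 0) as [_|n]; [|now elim n].
destruct (Req_dec_T u 0) as [->|n]; [apply ball_center|].
change (Rabs (atan u / u + - 1) < eps).
specialize (Hd u n). rewrite Ropp_0, Rplus_0_r in Hu.
specialize (Hd Hu). rewrite Rplus_0_l, atan_0 in Hd.
now rewrite Rminus_0_r in Hd.
Qed.

(* Equal to [- Arg (1 - t w) / t] for [t > 0]; the value at [0] is its limit. *)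
Definition li_kernel (x y t : R) : R :=
  if Req_dec_T t 0 then y else (PI / 2 - atan ((1 - t * x) / (t * y))) / t.

Lemma li_kernel_pos (x y t : R) : 0 < y -> 0 < t ->
  carg (Cminus 1 (Cmult (RtoC t) (x, y))) / t = - li_kernel x y t.
Proof.
intros Hy Ht. assert (0 < t * y) by now apply Rmult_lt_0_compat.
unfold li_kernel. destruct (Req_dec_T t 0); [lra|].
replace (Cminus 1 (Cmult (RtoC t) (x, y))) with ((1 - t * x, - (t * y)) : CC)
  by (unfold Cminus, Cplus, Copp, Cmult, RtoC; simpl; f_equal; ring).
rewrite carg_lower by lra. rewrite Ropp_involutive. field. lra.
Qed.

Lemma ex_RInt_li_kernel (x y : R) : 0 < y -> ex_RInt (li_kernel x y) 0 1.
Proof.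
intros Hy.
(* Up to this bound t x stays below 1, so that PI / 2 minus the arctangent of a reciprocal becomes
   an arctangent vanishing at t = 0; beyond it, t stays away from 0. *)
set (d := / (1 + Rabs x)).
pose proof (Rabs_pos x) as Hx.
assert (Hd : 0 < d) by (apply Rinv_0_lt_compat; lra).
assert (Hd1 : d <= 1) by (unfold d; rewrite <- Rinv_1; apply Rinv_le_contravar; lra).
assert (Hdx : forall t, 0 <= t <= d -> 0 < 1 - t * x).
{ intros t Ht. assert (d * (1 + Rabs x) = 1) by (unfold d; field; lra).
  pose proof (Rle_abs x). assert (t * x <= t * Rabs x) by (apply Rmult_le_compat_l; lra).
  assert (t * Rabs x <= d * Rabs x) by (apply Rmult_le_compat_r; lra). lra. }
apply (ex_RInt_Chasles _ 0 d 1).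
- apply ex_RInt_ext with (fun t => atan_quotient (t * y / (1 - t * x)) * (y / (1 - t * x))).
  + rewrite Rmin_left, Rmax_right by lra. intros t Ht. unfold li_kernel, atan_quotient.
    assert (0 < 1 - t * x) by (apply Hdx; lra).
    assert (0 < t * y) by (apply Rmult_lt_0_compat; lra).
    assert (0 < t * y / (1 - t * x)) by (apply Rdiv_lt_0_compat; lra).
    destruct (Req_dec_T t 0); [lra|]. destruct (Req_dec_T (t * y / (1 - t * x)) 0); [lra|].
    replace ((1 - t * x) / (t * y)) with (/ (t * y / (1 - t * x))) by (field; lra).
    rewrite atan_inv by assumption.
    match goal with |- ?a = ?b => change (@eq R a b) end.
    field. repeat split; lra.
  + apply (ex_RInt_continuous (V := R_CompleteNormedModule)). rewrite Rmin_left, Rmax_right by lra.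
    intros t Ht. assert (Hp := Hdx t Ht).
    assert (Hc : continuous (fun t => t * y / (1 - t * x)) t).
    { apply (ex_derive_continuous (fun t => t * y / (1 - t * x))). auto_derive. lra. }
    apply (continuous_mult (K := R_AbsRing)).
    * apply (continuous_comp (fun t => t * y / (1 - t * x)) atan_quotient); [exact Hc|].
      destruct (Req_dec_T t 0) as [->|n].
      { replace (0 * y / (1 - 0 * x)) with 0 by (field; lra). apply continuous_atan_quotient_0. }
      assert (0 < t * y / (1 - t * x)).
      { apply Rdiv_lt_0_compat; [|lra]. apply Rmult_lt_0_compat; lra. }
      apply continuous_ext_loc with (fun u => atan u / u).
      { exists (mkposreal _ H). intros u Hu. unfold atan_quotient.
        destruct (Req_dec_T u 0) as [->|]; [|reflexivity].
        unfold ball in Hu; simpl in Hu; unfold AbsRing_ball, minus, plus, opp, abs in Hu;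
        simpl in Hu. rewrite Rplus_0_l, Rabs_Ropp, Rabs_pos_eq in Hu; lra. }
      apply (ex_derive_continuous (fun u => atan u / u)). auto_derive. lra.
    * apply (ex_derive_continuous (fun t => y / (1 - t * x))). auto_derive. lra.
- apply (ex_RInt_continuous (V := R_CompleteNormedModule)).
  rewrite Rmin_left, Rmax_right by lra. intros t Ht.
  apply continuous_ext_loc with (fun t => (PI / 2 - atan ((1 - t * x) / (t * y))) / t).
  + exists (mkposreal _ Hd). intros u Hu. unfold li_kernel.
    destruct (Req_dec_T u 0) as [->|]; [|reflexivity].
    unfold ball in Hu; simpl in Hu; unfold AbsRing_ball, minus, plus, opp, abs in Hu;
    simpl in Hu. rewrite Rplus_0_l, Rabs_Ropp, Rabs_pos_eq in Hu; lra.
  + apply (ex_derive_continuous (fun t => (PI / 2 - atan ((1 - t * x) / (t * y))) / t)).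
    assert (t * y <> 0) by (apply Rmult_integral_contrapositive_currified; lra).
    auto_derive. repeat split; lra.
Qed.

(** * Derivative of the Bloch-Wigner function along a path in the upper half-plane *)

Section Path.
Variables (x y dx dy : R -> R) (s0 : R).
Hypothesis Hloc : locally s0 (fun s => is_derive x s (dx s) /\ is_derive y s (dy s) /\ 0 < y s).
Hypothesis Cdx : continuous dx s0.
Hypothesis Cdy : continuous dy s0.

(** The derivative of [li_kernel] in s: the division by t cancels, leaving a rational function
    without a pole at t = 0. *)
Let dker (s t : R) : R :=
  (t * y s * dx s + (1 - t * x s) * dy s) / ((1 - t * x s) ^ 2 + (t * y s) ^ 2).

Lemma den_pos (s t : R) : 0 < y s -> 0 < (1 - t * x s) ^ 2 + (t * y s) ^ 2.
Proof.
intros Hy. destruct (Req_dec t 0) as [->|n].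
- replace ((1 - 0 * x s) ^ 2 + (0 * y s) ^ 2) with 1 by ring. lra.
- assert (0 < (t * y s) ^ 2).
  { apply pow2_gt_0. apply Rmult_integral_contrapositive_currified; lra. }
  pose proof (pow2_ge_0 (1 - t * x s)). lra.
Qed.

Lemma is_derive_li_kernel (s t : R) :
  is_derive x s (dx s) -> is_derive y s (dy s) -> 0 < y s ->
  is_derive (fun u => li_kernel (x u) (y u) t) s (dker s t).
Proof.
intros Hx Hy Hp. unfold li_kernel, dker. destruct (Req_dec_T t 0) as [->|n].
- replace (_ / _) with (dy s) by (field; lra). exact Hy.
- assert (t * y s <> 0) by (apply Rmult_integral_contrapositive_currified; lra).
  pose proof (den_pos s t Hp).
  assert (0 < (t * y s) ^ 2) by now apply pow2_gt_0.
  evar_last.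
  { auto_derive. repeat split; try (eexists; eassumption); try assumption; try easy. reflexivity. }
  replace (Derive (fun u => x u) s) with (dx s) by (symmetry; now apply is_derive_unique).
  replace (Derive (fun u => y u) s) with (dy s) by (symmetry; now apply is_derive_unique).
  match goal with |- ?a = ?b => change (@eq R a b) end.
  unfold Rsqr. field.
  repeat split; try lra.
  all: try (intros E; apply Rmult_integral in E; destruct E; nra).
Qed.

Lemma is_derive_RInt_li_kernel :
  is_derive (fun s => RInt (li_kernel (x s) (y s)) 0 1) s0 (RInt (dker s0) 0 1).
Proof.
assert (H0 := locally_singleton _ _ Hloc). destruct H0 as (Hx0 & Hy0 & Hp0).
replace (RInt (dker s0) 0 1)
  with (RInt (fun t => Derive (fun s => li_kernel (x s) (y s) t) s0) 0 1).
2:{ apply RInt_ext. intros t _. apply is_derive_unique. now apply is_derive_li_kernel. }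
apply (is_derive_RInt_param (fun s t => li_kernel (x s) (y s) t)).
- revert Hloc. apply filter_imp. intros s (Hx & Hy & Hp) t _.
  exists (dker s t). now apply is_derive_li_kernel.
- intros t _. apply continuity_2d_pt_ext_loc with dker.
  { destruct Hloc as [e He]. exists e. intros u v Hu _. symmetry. apply is_derive_unique.
    destruct (He u Hu) as (Hx & Hy & Hp). now apply is_derive_li_kernel. }
  pose proof (den_pos s0 t Hp0) as Hd.
  assert (Hc1 : forall f, continuous f s0 -> continuity_2d_pt (fun u _ => f u) s0 t).
  { intros f Hf. apply (continuity_1d_2d_pt_comp f (fun u _ => u)).
    - now apply continuity_pt_filterlim.
    - apply continuity_2d_pt_id1. }
  assert (Cx : continuous x s0) by (apply (ex_derive_continuous x); now exists (dx s0)).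
  assert (Cy : continuous y s0) by (apply (ex_derive_continuous y); now exists (dy s0)).
  assert (H2 : forall f, continuity_2d_pt f s0 t -> continuity_2d_pt (fun u v => f u v ^ 2) s0 t).
  { intros f Hf. apply continuity_2d_pt_ext with (fun u v => f u v * f u v).
    - intros; ring.
    - now apply continuity_2d_pt_mult. }
  unfold dker, Rdiv.
  repeat first [ apply H2 | apply continuity_2d_pt_mult | apply continuity_2d_pt_plus
    | apply continuity_2d_pt_opp | apply continuity_2d_pt_inv
    | apply continuity_2d_pt_const | apply continuity_2d_pt_id2 | apply Hc1; assumption ].
  lra.
- revert Hloc. apply filter_imp. intros s (_ & _ & Hp). now apply ex_RInt_li_kernel.
Qed.

Lemma RInt_dker :
  RInt (dker s0) 0 1 =
  - ((dx s0 * x s0 + dy s0 * y s0) / (x s0 ^ 2 + y s0 ^ 2) * carg (1 - x s0, - y s0)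
     + (dy s0 * x s0 - dx s0 * y s0) / (x s0 ^ 2 + y s0 ^ 2)
       * (/ 2 * ln ((1 - x s0) ^ 2 + y s0 ^ 2))).
Proof.
assert (H0 := locally_singleton _ _ Hloc). destruct H0 as (_ & _ & Hp0).
assert (Hm : 0 < x s0 ^ 2 + y s0 ^ 2).
{ pose proof (pow2_ge_0 (x s0)). assert (0 < y s0 ^ 2) by (apply pow2_gt_0; lra). lra. }
(* A primitive in t by partial fractions; the coefficients are the derivatives of ln |w| and Arg w.
   The constant [- atan (x s0 / y s0)] makes [F 0] vanish, and [triangle_atan] turns the arctangents
   of [F 1] into Arg (1 - w). *)
set (F := fun t => - ((dx s0 * x s0 + dy s0 * y s0) / (x s0 ^ 2 + y s0 ^ 2)
       * (- atan ((t * (x s0 ^ 2 + y s0 ^ 2) - x s0) / y s0) - atan (x s0 / y s0))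
     + (dy s0 * x s0 - dx s0 * y s0) / (x s0 ^ 2 + y s0 ^ 2)
       * (/ 2 * ln ((1 - t * x s0) ^ 2 + (t * y s0) ^ 2)))).
assert (HF : is_RInt (dker s0) 0 1 (minus (F 1) (F 0))).
{ apply (is_RInt_derive (V := R_CompleteNormedModule) F (dker s0)).
  - intros t _. pose proof (den_pos s0 t Hp0) as Hd. unfold F, dker. evar_last.
    + auto_derive. repeat split; try assumption; lra. reflexivity.
    + match goal with |- ?a = ?b => change (@eq R a b) end.
      unfold Rsqr. field.
      assert (0 < y s0 * y s0) by (apply Rmult_lt_0_compat; lra).
      set (k := t * (x s0 * x s0 + y s0 * y s0) + - x s0).
      pose proof (Rle_0_sqr k) as Hk. unfold Rsqr in Hk.
      repeat split; lra.
  - intros t _. pose proof (den_pos s0 t Hp0) as Hd. unfold dker.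
    apply (ex_derive_continuous (fun t => (t * y s0 * dx s0 + (1 - t * x s0) * dy s0)
      / ((1 - t * x s0) ^ 2 + (t * y s0) ^ 2))).
    auto_derive. lra. }
rewrite (is_RInt_unique _ _ _ _ HF).
change (F 1 - F 0 =
  - ((dx s0 * x s0 + dy s0 * y s0) / (x s0 ^ 2 + y s0 ^ 2) * carg (1 - x s0, - y s0)
     + (dy s0 * x s0 - dx s0 * y s0) / (x s0 ^ 2 + y s0 ^ 2)
       * (/ 2 * ln ((1 - x s0) ^ 2 + y s0 ^ 2)))).
unfold F. rewrite carg_lower by lra.
replace ((1 * (x s0 ^ 2 + y s0 ^ 2) - x s0) / y s0)
  with ((x s0 * x s0 + y s0 * y s0 - x s0) / y s0) by (f_equal; ring).
rewrite triangle_atan by assumption.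
replace ((0 * (x s0 ^ 2 + y s0 ^ 2) - x s0) / y s0) with (- (x s0 / y s0)) by (field; lra).
rewrite atan_opp, !Ropp_involutive.
replace ((1 - 0 * x s0) ^ 2 + (0 * y s0) ^ 2) with 1 by ring.
rewrite ln_1, !Rmult_1_l. field. lra.
Qed.

(** This is the imaginary part of dLi2 = - Log (1 - w) dw / w. *)
Lemma is_derive_ImLi2 :
  is_derive (fun s => ImLi2 (x s, y s)) s0
  (- ((dx s0 * x s0 + dy s0 * y s0) / (x s0 ^ 2 + y s0 ^ 2) * carg (1 - x s0, - y s0)
     + (dy s0 * x s0 - dx s0 * y s0) / (x s0 ^ 2 + y s0 ^ 2)
       * (/ 2 * ln ((1 - x s0) ^ 2 + y s0 ^ 2)))).
Proof.
rewrite <- RInt_dker.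
apply is_derive_ext_loc with (2 := is_derive_RInt_li_kernel).
revert Hloc. apply filter_imp. intros s (_ & _ & Hp). unfold ImLi2.
rewrite <- (Ropp_involutive (RInt _ _ _)). apply f_equal.
transitivity (RInt (fun t => opp (li_kernel (x s) (y s) t)) 0 1).
- symmetry. apply (RInt_opp (V := R_CompleteNormedModule)). now apply ex_RInt_li_kernel.
- apply RInt_ext. rewrite Rmin_left, Rmax_right by lra. intros t Ht.
  symmetry. apply li_kernel_pos; [assumption|apply Ht].
Qed.

Lemma Cmod_ln (a b : R) : 0 < a ^ 2 + b ^ 2 -> ln (Cmod (a, b)) = / 2 * ln (a ^ 2 + b ^ 2).
Proof.
intros H. unfold Cmod; simpl fst; simpl snd.
rewrite <- (Rpower_sqrt _ H). unfold Rpower. now rewrite ln_exp.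
Qed.

(** The product rule for ln |w| Arg (1 - w) yields a term in Arg (1 - w) that cancels the one from
    Im Li2. *)
Lemma is_derive_BlochWigner :
  is_derive (fun s => BlochWigner (x s, y s)) s0
  (- (/ 2 * ln (x s0 ^ 2 + y s0 ^ 2)
        * ((dx s0 * y s0 + dy s0 * (1 - x s0)) / ((1 - x s0) ^ 2 + y s0 ^ 2)))
   - / 2 * ln ((1 - x s0) ^ 2 + y s0 ^ 2)
        * ((dy s0 * x s0 - dx s0 * y s0) / (x s0 ^ 2 + y s0 ^ 2))).
Proof.
assert (H0 := locally_singleton _ _ Hloc). destruct H0 as (Hx0 & Hy0 & Hp0).
assert (Hm : 0 < x s0 ^ 2 + y s0 ^ 2).
{ pose proof (pow2_ge_0 (x s0)). assert (0 < y s0 ^ 2) by (apply pow2_gt_0; lra). lra. }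
assert (Hm1 : 0 < (1 - x s0) ^ 2 + y s0 ^ 2).
{ pose proof (pow2_ge_0 (1 - x s0)). assert (0 < y s0 ^ 2) by (apply pow2_gt_0; lra). lra. }
assert (Hl : is_derive
  (fun s => / 2 * ln (x s ^ 2 + y s ^ 2) * (atan ((1 - x s) / y s) - PI / 2)) s0
  ((dx s0 * x s0 + dy s0 * y s0) / (x s0 ^ 2 + y s0 ^ 2) * (atan ((1 - x s0) / y s0) - PI / 2)
   - / 2 * ln (x s0 ^ 2 + y s0 ^ 2)
        * ((dx s0 * y s0 + dy s0 * (1 - x s0)) / ((1 - x s0) ^ 2 + y s0 ^ 2)))).
{ evar_last.
  - auto_derive. repeat split; try (eexists; eassumption); try assumption; try lra. reflexivity.
  - replace (Derive (fun u => x u) s0) with (dx s0) by (symmetry; now apply is_derive_unique).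
    replace (Derive (fun u => y u) s0) with (dy s0) by (symmetry; now apply is_derive_unique).
    match goal with |- ?a = ?b => change (@eq R a b) end.
    replace (x s0 * (x s0 * 1) + y s0 * (y s0 * 1)) with (x s0 ^ 2 + y s0 ^ 2) by ring.
    change ((1 + - x s0) * / y s0) with ((1 - x s0) / y s0).
    field. repeat split; lra. }
apply is_derive_ext_loc with (fun s => ImLi2 (x s, y s)
  + / 2 * ln (x s ^ 2 + y s ^ 2) * (atan ((1 - x s) / y s) - PI / 2)).
- revert Hloc. apply filter_imp. intros s (_ & _ & Hp). unfold BlochWigner.
  rewrite Cmod_ln.
  2:{ pose proof (pow2_ge_0 (x s)). assert (0 < y s ^ 2) by (apply pow2_gt_0; lra). lra. }
  do 2 f_equal. 
  replace (Cminus 1 (x s, y s)) with ((1 - x s, - y s) : CC)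
    by (unfold Cminus, Cplus, Copp, RtoC; simpl; f_equal; ring).
  now rewrite carg_lower, Ropp_involutive by lra.
- evar_last.
  + exact (is_derive_plus (V := R_NormedModule) _ _ s0 _ _ is_derive_ImLi2 Hl).
  + unfold plus; simpl. rewrite carg_lower, Ropp_involutive by lra. field. lra.
Qed.
End Path.

(** * First derivative of the volume of a moving triangle *)

Definition mov (b p : CC) (s : R) : CC := (fst b + s * fst p, snd b + s * snd p).
Definition nsq (b : CC) : R := fst b ^ 2 + snd b ^ 2.
Definition cross (b c : CC) : R := fst b * snd c - snd b * fst c.
Definition dot (b c : CC) : R := fst b * fst c + snd b * snd c.
(** [dlog b p] and [darg b p] are the real and imaginary parts of p / b, the derivatives of ln |b|
    and of the argument of b in direction p. *)
Definition dlog (b p : CC) : R := dot b p / nsq b.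
Definition darg (b p : CC) : R := cross b p / nsq b.

(* Schlaefli's formula for the triangle (0, b, c): minus the sum over the sides of the
   log-length times the differential of the opposite angle, where the angles sum to PI. *)
Definition dVol (b c p r : CC) : R :=
  / 2 * (ln (nsq c) - ln (nsq b)) * (darg (Cminus b c) (Cminus p r) - darg b p)
  - / 2 * (ln (nsq (Cminus b c)) - ln (nsq b)) * (darg c r - darg b p).

Lemma nsq_pos_cross (b c : CC) : 0 < cross b c -> 0 < nsq b /\ 0 < nsq c /\ 0 < nsq (Cminus b c).
Proof.
assert (H : forall b c, cross b c <> 0 -> 0 < nsq b).
{ intros [b1 b2] [c1 c2]; unfold cross, nsq; simpl. intros H.
  assert (~ (b1 = 0 /\ b2 = 0)) by (intros [-> ->]; apply H; ring).
  destruct (Req_dec b1 0) as [->|]; [destruct (Req_dec b2 0) as [->|]; [tauto|]|];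
  nra. }
intros Hc. repeat split.
- apply (H b c); lra.
- apply (H c b). unfold cross in *. lra.
- apply (H _ b). unfold cross in *. destruct b, c; simpl in *. lra.
Qed.

Lemma cross_mov_pos (b c p r : CC) : 0 < cross b c ->
  locally 0 (fun s => 0 < cross (mov b p s) (mov c r s)).
Proof.
intros H.
assert (Hc : continuous (fun s => cross (mov b p s) (mov c r s)) 0).
{ apply (ex_derive_continuous (fun s => cross (mov b p s) (mov c r s))).
  unfold cross, mov; simpl. now auto_derive. }
apply (Hc (fun v => 0 < v)).
apply (open_gt 0). unfold cross, mov in *; simpl. rewrite !Rmult_0_l, !Rplus_0_r. exact H.
Qed.

(** For w = c / b one has 1 - w = (b - c) / b, so the logarithms and argument differentials of w and
    1 - w are differences of those of the sides. *)
Lemma is_derive_Vol_mov (b c p r : CC) : 0 < cross b c ->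
  is_derive (fun s => BlochWigner (Cdiv (mov c r s) (mov b p s))) 0 (dVol b c p r).
Proof.
intros H.
assert (Hn := nsq_pos_cross b c H). destruct Hn as (Hb & Hc & Hbc).
destruct b as [b1 b2], c as [c1 c2], p as [p1 p2], r as [r1 r2].
set (x := fun s => ((c1 + s * r1) * (b1 + s * p1) + (c2 + s * r2) * (b2 + s * p2))
            / ((b1 + s * p1) ^ 2 + (b2 + s * p2) ^ 2)).
set (y := fun s => ((c2 + s * r2) * (b1 + s * p1) - (c1 + s * r1) * (b2 + s * p2))
            / ((b1 + s * p1) ^ 2 + (b2 + s * p2) ^ 2)).
apply is_derive_ext with (fun s => BlochWigner (x s, y s)).
{ intros s. f_equal. unfold x, y, mov, Cdiv, Cinv, Cmult; simpl fst; simpl snd.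
  
  change ((b1 + s * p1) * ((b1 + s * p1) * 1) + (b2 + s * p2) * ((b2 + s * p2) * 1))
    with ((b1 + s * p1) ^ 2 + (b2 + s * p2) ^ 2).
  f_equal; unfold Rdiv; ring. }
set (n := fun s => (b1 + s * p1) ^ 2 + (b2 + s * p2) ^ 2).
set (dn := fun s => 2 * ((b1 + s * p1) * p1 + (b2 + s * p2) * p2)).
set (dx := fun s => (r1 * (b1 + s * p1) + (c1 + s * r1) * p1 + r2 * (b2 + s * p2)
            + (c2 + s * r2) * p2 - x s * dn s) / n s).
set (dy := fun s => (r2 * (b1 + s * p1) + (c2 + s * r2) * p1 - r1 * (b2 + s * p2)
            - (c1 + s * r1) * p2 - y s * dn s) / n s).
unfold nsq, cross, Cminus, Cplus, Copp in *; simpl fst in *; simpl snd in *.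
evar_last.
- apply (is_derive_BlochWigner x y dx dy).
  + generalize (cross_mov_pos (b1, b2) (c1, c2) (p1, p2) (r1, r2) H). apply filter_imp.
    intros s Hs. assert (Hs' := nsq_pos_cross _ _ Hs). destruct Hs' as (Hs' & _ & _).
    unfold nsq, cross, mov in *; simpl fst in *; simpl snd in *.
    split; [|split].
    * unfold x, dx. evar_last. auto_derive. lra. reflexivity.
      match goal with |- ?a = ?b => change (@eq R a b) end.
      unfold x, dn, n. field. lra.
    * unfold y, dy. evar_last. auto_derive. lra. reflexivity.
      match goal with |- ?a = ?b => change (@eq R a b) end.
      unfold y, dn, n. field. lra.
    * unfold y. apply Rdiv_lt_0_compat; lra.
  + apply (ex_derive_continuous dx). unfold dx, x, dn, n. auto_derive.
    rewrite !Rmult_0_l, !Rplus_0_r. lra.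
  + apply (ex_derive_continuous dy). unfold dy, y, dn, n. auto_derive.
    rewrite !Rmult_0_l, !Rplus_0_r. lra.
- match goal with |- ?a = ?b => change (@eq R a b) end.
  assert (E1 : x 0 ^ 2 + y 0 ^ 2 = (c1 ^ 2 + c2 ^ 2) / (b1 ^ 2 + b2 ^ 2)).
  { unfold x, y. rewrite !Rmult_0_l, !Rplus_0_r. field. lra. }
  assert (E2 : (1 - x 0) ^ 2 + y 0 ^ 2 =
     ((b1 + - c1) ^ 2 + (b2 + - c2) ^ 2) / (b1 ^ 2 + b2 ^ 2)).
  { unfold x, y. rewrite !Rmult_0_l, !Rplus_0_r. field. lra. }
  rewrite E1, E2. unfold Rdiv at 1 4. 
  rewrite !ln_mult, !ln_Rinv; try assumption; try now apply Rinv_0_lt_compat.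
  unfold dVol, darg, nsq, cross, Cminus, Cplus, Copp; simpl fst; simpl snd.
  unfold dx, dy, dn, x, y, n. rewrite !Rmult_0_l, !Rplus_0_r.
  field. lra.
Qed.

(** * Second derivative and complex Hessian of the volume *)

(** The imaginary part of - p q / b^2, which is the derivative of p / b when b moves with velocity
    q. *)
Definition ddarg (b p q : CC) : R :=
  (cross q p * nsq b - 2 * dot b q * cross b p) / nsq b ^ 2.

Definition ddVol (b c p r q t : CC) : R :=
  (dlog c t - dlog b q) * (darg (Cminus b c) (Cminus p r) - darg b p)
  + / 2 * (ln (nsq c) - ln (nsq b))
    * (ddarg (Cminus b c) (Cminus p r) (Cminus q t) - ddarg b p q)
  - (dlog (Cminus b c) (Cminus q t) - dlog b q) * (darg c r - darg b p)
  - / 2 * (ln (nsq (Cminus b c)) - ln (nsq b)) * (ddarg c r t - ddarg b p q).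

Lemma mov_0 (b p : CC) : mov b p 0 = b.
Proof. destruct b; unfold mov; simpl. f_equal; ring. Qed.

Lemma mov_minus (b c p r : CC) (s : R) :
  Cminus (mov b p s) (mov c r s) = mov (Cminus b c) (Cminus p r) s.
Proof.
unfold mov, Cminus, Cplus, Copp; simpl. f_equal; ring.
Qed.

Lemma is_derive_ln_nsq (b q : CC) : 0 < nsq b ->
  is_derive (fun s => / 2 * ln (nsq (mov b q s))) 0 (dlog b q).
Proof.
destruct b as [b1 b2], q as [q1 q2]. unfold dlog, dot, nsq, mov; simpl fst; simpl snd.
intros H. evar_last.
- auto_derive. { rewrite !Rmult_0_l, !Rplus_0_r. lra. } reflexivity.
- match goal with |- ?a = ?b => change (@eq R a b) end.
  rewrite !Rmult_0_l, !Rplus_0_r. field. simpl in H. lra.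
Qed.

Lemma is_derive_darg (b p q : CC) : 0 < nsq b ->
  is_derive (fun s => darg (mov b q s) p) 0 (ddarg b p q).
Proof.
destruct b as [b1 b2], q as [q1 q2], p as [p1 p2].
unfold darg, ddarg, cross, dot, nsq, mov; simpl fst; simpl snd.
intros H. evar_last.
- auto_derive. { rewrite !Rmult_0_l, !Rplus_0_r. lra. } reflexivity.
- match goal with |- ?a = ?b => change (@eq R a b) end.
  rewrite !Rmult_0_l, !Rplus_0_r. field. simpl in H. lra.
Qed.

Lemma is_derive_dVol (b c p r q t : CC) : 0 < cross b c ->
  is_derive (fun s => dVol (mov b q s) (mov c t s) p r) 0 (ddVol b c p r q t).
Proof.
intros H. assert (Hn := nsq_pos_cross b c H). destruct Hn as (Hb & Hc & Hbc).
set (l1 := fun s => / 2 * ln (nsq (mov b q s))).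
set (l2 := fun s => / 2 * ln (nsq (mov c t s))).
set (l3 := fun s => / 2 * ln (nsq (mov (Cminus b c) (Cminus q t) s))).
set (t1 := fun s => darg (mov b q s) p).
set (t2 := fun s => darg (mov c t s) r).
set (t3 := fun s => darg (mov (Cminus b c) (Cminus q t) s) (Cminus p r)).
assert (D1 : is_derive l1 0 (dlog b q)) by now apply is_derive_ln_nsq.
assert (D2 : is_derive l2 0 (dlog c t)) by now apply is_derive_ln_nsq.
assert (D3 : is_derive l3 0 (dlog (Cminus b c) (Cminus q t))) by now apply is_derive_ln_nsq.
assert (D4 : is_derive t1 0 (ddarg b p q)) by now apply is_derive_darg.
assert (D5 : is_derive t2 0 (ddarg c r t)) by now apply is_derive_darg.
assert (D6 : is_derive t3 0 (ddarg (Cminus b c) (Cminus p r) (Cminus q t)))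
  by now apply is_derive_darg.
apply is_derive_ext with (fun s => (l2 s - l1 s) * (t3 s - t1 s) - (l3 s - l1 s) * (t2 s - t1 s)).
{ intros s. match goal with |- ?a = ?b => change (@eq R a b) end.
  unfold dVol. rewrite mov_minus. unfold l1, l2, l3, t1, t2, t3. ring. }
evar_last.
- auto_derive. { repeat split; eexists; eassumption. } reflexivity.
- match goal with |- ?a = ?b => change (@eq R a b) end.
  repeat match goal with D : is_derive ?f 0 ?l |- _ =>
    replace (Derive (fun s => f s) 0) with l by (symmetry; now apply is_derive_unique);
    clear D end.
  unfold l1, l2, l3, t1, t2, t3. rewrite !mov_0. unfold ddVol. ring.
Qed.

Definition axis (d : bool) : CC := if d then (1, 0) else (0, 1).
Definition rscale (k : R) (e : CC) : CC := (k * fst e, k * snd e).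

(* The (u, v) entry of the form - d dbar Vol of the triangle (0, b, c), when z_u moves
   the vertices at velocity (ub, uc) and z_v at velocity (vb, vc). *)
Definition face_form (b c : CC) (ub uc vb vc : R) : CC :=
  Cmult (RtoC (cross b c / (2 * nsq b * nsq c * nsq (Cminus b c))))
    (Cmult (Cminus (rscale uc b) (rscale ub c))
           (Cconj (Cminus (rscale vc b) (rscale vb c)))).

(** The logarithms multiply values of [ddarg], the imaginary part of a symmetric complex bilinear
    form in the two directions: its values at (1, 1) and (i, i) are opposite and those at (1, i) and
    (i, 1) agree, so these terms cancel. Products of [dlog] and [darg] remain. *)
Lemma ddVol_wirtinger (b c : CC) (ub uc vb vc : R) : 0 < cross b c ->
  let H d e := ddVol b c (rscale vb (axis e)) (rscale vc (axis e))
                         (rscale ub (axis d)) (rscale uc (axis d)) in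
  Cmult (RtoC (/ 4)) (Cplus (RtoC (- H true true + - H false false))
     (Cmult Ci (RtoC (- H true false - - H false true)))) = face_form b c ub uc vb vc.
Proof.
intros Hbc. assert (Hn := nsq_pos_cross b c Hbc). destruct Hn as (Hb & Hc & Hd).
intros H.
assert (E1 : - H true true + - H false false = 4 * fst (face_form b c ub uc vb vc)).
{ unfold H, face_form, ddVol, ddarg, dlog, darg. clear H.
  destruct b as [b1 b2], c as [c1 c2].
  unfold dot, cross, nsq, axis, rscale, Cconj, Cminus, Cplus, Copp, Cmult, RtoC in *;
  simpl fst in *; simpl snd in *. field. lra. }
assert (E2 : - H true false - - H false true = 4 * snd (face_form b c ub uc vb vc)).
{ unfold H, face_form, ddVol, ddarg, dlog, darg. clear E1 H.
  destruct b as [b1 b2], c as [c1 c2].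
  unfold dot, cross, nsq, axis, rscale, Cconj, Cminus, Cplus, Copp, Cmult, RtoC in *;
  simpl fst in *; simpl snd in *. field. lra. }
rewrite E1, E2. destruct (face_form b c ub uc vb vc) as [f1 f2].
unfold Cmult, Cplus, RtoC, Ci; simpl. f_equal; field.
Qed.

(** * Derivatives of the prepotential as sums over triangles *)

Definition rsum {A : Type} (f : A -> R) (l : list A) : R :=
  fold_right (fun t acc => f t + acc) 0 l.
Definition lsum {A : Type} (f : A -> CC) (l : list A) : CC :=
  fold_right (fun t acc => Cplus (f t) acc) (RtoC 0) l.

Definition edge1 (P : nat -> CC) (t : tri) : CC := let '(a, b, c) := t in Cminus (P b) (P a).
Definition edge2 (P : nat -> CC) (t : tri) : CC := let '(a, b, c) := t in Cminus (P c) (P a).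
Definition kron (k u : nat) : R := if Nat.eqb k u then 1 else 0.
Definition vel1 (t : tri) (u : nat) : R := let '(a, b, c) := t in kron b u - kron a u.
Definition vel2 (t : tri) (u : nat) : R := let '(a, b, c) := t in kron c u - kron a u.
Definition ccw (P : nat -> CC) (t : tri) : Prop := 0 < cross (edge1 P t) (edge2 P t).

Lemma is_derive_rsum {A : Type} (f : A -> R -> R) (df : A -> R) (l : list A) (x : R) :
  (forall t, In t l -> is_derive (f t) x (df t)) ->
  is_derive (fun s => rsum (fun t => f t s) l) x (rsum df l).
Proof.
induction l as [|t l IH]; intros H; simpl.
- apply (is_derive_const (V := R_NormedModule)).
- apply (is_derive_plus (V := R_NormedModule) (f t)).
  + apply H; now left.
  + apply IH. intros s Hs. apply H; now right.
Qed.

Lemma rsum_ext {A : Type} (f g : A -> R) (l : list A) :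
  (forall t, In t l -> f t = g t) -> rsum f l = rsum g l.
Proof.
induction l as [|t l IH]; intros H; simpl; [reflexivity|].
rewrite H by now left. f_equal. apply IH. intros; apply H; now right.
Qed.

Lemma lsum_ext {A : Type} (f g : A -> CC) (l : list A) :
  (forall t, In t l -> f t = g t) -> lsum f l = lsum g l.
Proof.
induction l as [|t l IH]; intros H; simpl; [reflexivity|].
rewrite H by now left. f_equal. apply IH. intros; apply H; now right.
Qed.

Section Config.
Variables (z1 z2 z3 : CC).
Local Notation pt := (pts z1 z2 z3).

Lemma A_T_rsum (T : list tri) (z : nat -> CC) :
  A_T z1 z2 z3 T z = - rsum (fun t => BlochWigner (Cdiv (edge2 (pt z) t) (edge1 (pt z) t))) T.
Proof.
unfold A_T. f_equal. induction T as [|[[a b] c] T IH]; simpl; [reflexivity|].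
now rewrite IH.
Qed.

Definition bump (z : nat -> CC) (u : nat) (d : bool) (s : R) : nat -> CC :=
  shift z u (if d then RtoC s else Cmult (RtoC s) Ci).

Lemma pts_bump (z : nat -> CC) (u : nat) (d : bool) (s : R) (k : nat) : (4 <= u)%nat ->
  pt (bump z u d s) k = mov (pt z k) (rscale (kron k u) (axis d)) s.
Proof.
intros Hu.
assert (E : forall k, bump z u d s k = mov (z k) (rscale (kron k u) (axis d)) s).
{ clear k. intros k. unfold bump, shift, mov, rscale, kron, axis.
  destruct (Nat.eqb k u); destruct d; destruct (z k);
  unfold Cplus, Cmult, RtoC, Ci; simpl; f_equal; ring. }
assert (F : forall k e, k <> u -> mov (pt z k) (rscale (kron k u) e) s = pt z k).
{ clear k. intros k e Hk. unfold kron. rewrite (proj2 (Nat.eqb_neq k u) Hk).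
  unfold mov, rscale. destruct (pt z k); simpl. f_equal; ring. }
destruct k as [|[|[|[|k]]]]; try (rewrite F by lia; reflexivity); apply E.
Qed.

Lemma edges_bump (z : nat -> CC) (u : nat) (d : bool) (s : R) (t : tri) : (4 <= u)%nat ->
  edge1 (pt (bump z u d s)) t = mov (edge1 (pt z) t) (rscale (vel1 t u) (axis d)) s /\
  edge2 (pt (bump z u d s)) t = mov (edge2 (pt z) t) (rscale (vel2 t u) (axis d)) s.
Proof.
intros Hu. destruct t as [[a b] c]. unfold edge1, edge2, vel1, vel2.
rewrite !pts_bump, !mov_minus by assumption.
split; f_equal; unfold rscale, Cminus, Cplus, Copp; simpl; f_equal; ring.
Qed.

Lemma ccw_bump (z : nat -> CC) (u : nat) (d : bool) (T : list tri) : (4 <= u)%nat ->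
  (forall t, In t T -> ccw (pt z) t) ->
  locally 0 (fun s => forall t, In t T -> ccw (pt (bump z u d s)) t).
Proof.
intros Hu. induction T as [|t T IH]; intros H.
- apply filter_forall. intros s t [].
- assert (H1 : locally 0 (fun s => ccw (pt (bump z u d s)) t)).
  { generalize (cross_mov_pos (edge1 (pt z) t) (edge2 (pt z) t)
      (rscale (vel1 t u) (axis d)) (rscale (vel2 t u) (axis d)) (H t (or_introl eq_refl))).
    apply filter_imp. intros s Hs. unfold ccw.
    destruct (edges_bump z u d s t Hu) as [-> ->]. exact Hs. }
  generalize (filter_and _ _ H1 (IH (fun s Hs => H s (or_intror Hs)))).
  apply filter_imp. intros s [Ha Hb] t' [<-|Ht']; auto.
Qed.

Lemma rpartial_A_T (T : list tri) (v : nat) (d : bool) (z : nat -> CC) : (4 <= v)%nat ->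
  (forall t, In t T -> ccw (pt z) t) ->
  rpartial v d (A_T z1 z2 z3 T) z =
  - rsum (fun t => dVol (edge1 (pt z) t) (edge2 (pt z) t)
       (rscale (vel1 t v) (axis d)) (rscale (vel2 t v) (axis d))) T.
Proof.
intros Hv HT. unfold rpartial. apply is_derive_unique.
apply is_derive_ext with (fun s => - rsum (fun t => BlochWigner
  (Cdiv (mov (edge2 (pt z) t) (rscale (vel2 t v) (axis d)) s)
        (mov (edge1 (pt z) t) (rscale (vel1 t v) (axis d)) s))) T).
- intros s. fold (bump z v d s). rewrite A_T_rsum. f_equal. apply rsum_ext.
  intros t _. now destruct (edges_bump z v d s t Hv) as [-> ->].
- apply (is_derive_opp (V := R_NormedModule)). apply is_derive_rsum. intros t Ht.
  apply is_derive_Vol_mov. now apply HT.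
Qed.

Lemma rpartial2_A_T (T : list tri) (u v : nat) (d e : bool) (z : nat -> CC) :
  (4 <= u)%nat -> (4 <= v)%nat ->
  (forall t, In t T -> ccw (pt z) t) ->
  rpartial u d (rpartial v e (A_T z1 z2 z3 T)) z =
  - rsum (fun t => ddVol (edge1 (pt z) t) (edge2 (pt z) t)
       (rscale (vel1 t v) (axis e)) (rscale (vel2 t v) (axis e))
       (rscale (vel1 t u) (axis d)) (rscale (vel2 t u) (axis d))) T.
Proof.
intros Hu Hv HT. unfold rpartial at 1. apply is_derive_unique.
apply is_derive_ext_loc with (fun s => - rsum (fun t => dVol
  (mov (edge1 (pt z) t) (rscale (vel1 t u) (axis d)) s)
  (mov (edge2 (pt z) t) (rscale (vel2 t u) (axis d)) s)
  (rscale (vel1 t v) (axis e)) (rscale (vel2 t v) (axis e))) T).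
(* The inner partial derivative is known only where the triangles are counterclockwise, which
   persists for small s. *)
- generalize (ccw_bump z u d T Hu HT). apply filter_imp. intros s Hs.
  fold (bump z u d s). rewrite rpartial_A_T by assumption. f_equal. apply rsum_ext.
  intros t _. now destruct (edges_bump z u d s t Hu) as [-> ->].
- apply (is_derive_opp (V := R_NormedModule)). apply is_derive_rsum. intros t Ht.
  apply is_derive_dVol. now apply HT.
Qed.

Definition tri_form (P : nat -> CC) (u v : nat) (t : tri) : CC :=
  face_form (edge1 P t) (edge2 P t) (vel1 t u) (vel2 t u) (vel1 t v) (vel2 t v).

Lemma Dform_lsum (T : list tri) (u v : nat) (z : nat -> CC) :
  (4 <= u)%nat -> (4 <= v)%nat ->
  (forall t, In t T -> ccw (pt z) t) ->
  Dform z1 z2 z3 T z u v = lsum (tri_form (pt z) u v) T.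
Proof.
intros Hu Hv HT. unfold Dform, wirtinger2. rewrite !rpartial2_A_T by assumption.
induction T as [|t T IH]; simpl.
- unfold Cmult, Cplus, RtoC, Ci; simpl; f_equal; ring.
- rewrite <- IH by (intros s Hs; apply HT; now right).
  unfold tri_form. rewrite <- ddVol_wirtinger by (apply HT; now left).
  unfold Cmult, Cplus, RtoC, Ci; simpl; f_equal; ring.
Qed.
End Config.

(** * Positivity *)

Lemma lsum_plus {A : Type} (f g : A -> CC) (l : list A) :
  lsum (fun t => Cplus (f t) (g t)) l = Cplus (lsum f l) (lsum g l).
Proof.
induction l as [|t l IH]; simpl.
- symmetry. apply Cplus_0_r.
- rewrite IH. unfold Cplus; simpl; f_equal; ring.
Qed.

Lemma lsum_mult {A : Type} (a : CC) (f : A -> CC) (l : list A) :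
  lsum (fun t => Cmult a (f t)) l = Cmult a (lsum f l).
Proof.
induction l as [|t l IH]; simpl.
- symmetry. apply Cmult_0_r.
- now rewrite IH, Cmult_plus_distr_l.
Qed.

Lemma lsum_mult_r {A : Type} (a : CC) (f : A -> CC) (l : list A) :
  lsum (fun t => Cmult (f t) a) l = Cmult (lsum f l) a.
Proof.
rewrite Cmult_comm, <- lsum_mult. apply lsum_ext. intros; apply Cmult_comm.
Qed.

Lemma lsum_conj {A : Type} (f : A -> CC) (l : list A) :
  lsum (fun t => Cconj (f t)) l = Cconj (lsum f l).
Proof.
induction l as [|t l IH]; simpl.
- unfold Cconj, RtoC; simpl; f_equal; ring.
- rewrite IH. unfold Cconj, Cplus; simpl; f_equal; ring.
Qed.

Lemma lsum_0 {A : Type} (f : A -> CC) (l : list A) :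
  (forall t, In t l -> f t = RtoC 0) -> lsum f l = RtoC 0.
Proof.
induction l as [|t l IH]; intros H; simpl; [reflexivity|].
rewrite (H t), IH, Cplus_0_r; [reflexivity| |now left]. intros; apply H; now right.
Qed.

Lemma lsum_swap {A B : Type} (f : A -> B -> CC) (l : list A) (m : list B) :
  lsum (fun a => lsum (f a) m) l = lsum (fun b => lsum (fun a => f a b) l) m.
Proof.
induction l as [|a l IH]; simpl.
- symmetry. now apply lsum_0.
- now rewrite IH, <- lsum_plus.
Qed.

Definition tri_weight (P : nat -> CC) (t : tri) : R :=
  cross (edge1 P t) (edge2 P t)
    / (2 * nsq (edge1 P t) * nsq (edge2 P t) * nsq (Cminus (edge1 P t) (edge2 P t))).

(** The vector m of the rank one form, extended by 0 to the points that are not vertices of t. *)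
Definition tri_vec (P : nat -> CC) (t : tri) (u : nat) : CC :=
  Cminus (rscale (vel2 t u) (edge1 P t)) (rscale (vel1 t u) (edge2 P t)).

Lemma tri_form_eq (P : nat -> CC) (u v : nat) (t : tri) :
  tri_form P u v t =
  Cmult (RtoC (tri_weight P t)) (Cmult (tri_vec P t u) (Cconj (tri_vec P t v))).
Proof. reflexivity. Qed.

Lemma tri_weight_pos (P : nat -> CC) (t : tri) : ccw P t -> 0 < tri_weight P t.
Proof.
intros H. destruct (nsq_pos_cross _ _ H) as (H1 & H2 & H3).
unfold tri_weight. apply Rdiv_lt_0_compat; [exact H|].
repeat apply Rmult_lt_0_compat; lra.
Qed.

Lemma lsum_square_nonneg {A : Type} (k : A -> R) (M : A -> CC) (l : list A) :
  (forall t, In t l -> 0 <= k t) ->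
  let s := lsum (fun t => Cmult (RtoC (k t)) (Cmult (M t) (Cconj (M t)))) l in
  Im s = 0 /\ 0 <= Re s.
Proof.
induction l as [|t l IH]; simpl; intros H; [split; [reflexivity|lra]|].
destruct IH as [I1 I2]; [intros; apply H; now right|].
unfold Im, Re in *; simpl. assert (Hk := H t (or_introl eq_refl)). destruct (M t) as [a b]. split.
- simpl. rewrite I1. ring.
- assert (0 <= k t * (a * a + b * b)); [|simpl; lra].
  apply Rmult_le_pos; [exact Hk|].
  pose proof (Rle_0_sqr a); pose proof (Rle_0_sqr b); unfold Rsqr in *; lra.
Qed.

Lemma hermitian_value_nonneg (N : nat) (D : nat -> nat -> CC) (P : nat -> CC)
    (T : list tri) (xi : nat -> CC) :
  (forall t, In t T -> ccw P t) ->
  (forall u v, (4 <= u)%nat -> (4 <= v)%nat -> D u v = lsum (tri_form P u v) T) ->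
  Im (hermitian_value N D xi) = 0 /\ 0 <= Re (hermitian_value N D xi).
Proof.
intros HT HD.
(* For each triangle the double sum over u and v factors into the squared modulus of this single
   sum. *)
set (M := fun t => lsum (fun u => Cmult (xi u) (tri_vec P t u)) (seq 4 N)).
replace (hermitian_value N D xi) with
  (lsum (fun t => Cmult (RtoC (tri_weight P t)) (Cmult (M t) (Cconj (M t)))) T).
{ apply lsum_square_nonneg. intros t Ht. now apply Rlt_le, tri_weight_pos, HT. }
change (hermitian_value N D xi) with (lsum (fun u => lsum (fun v =>
  Cmult (Cmult (xi u) (D u v)) (Cconj (xi v))) (seq 4 N)) (seq 4 N)).
transitivity (lsum (fun u => lsum (fun v => lsum (fun t =>
  Cmult (Cmult (xi u) (tri_form P u v t)) (Cconj (xi v))) T) (seq 4 N)) (seq 4 N)).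
- transitivity (lsum (fun u => lsum (fun t => lsum (fun v =>
    Cmult (Cmult (xi u) (tri_form P u v t)) (Cconj (xi v))) (seq 4 N)) T) (seq 4 N)).
  2:{ apply lsum_ext. intros u _. apply lsum_swap. }
  rewrite lsum_swap. apply lsum_ext. intros t _.
  unfold M at 1. rewrite <- lsum_mult_r, <- lsum_mult. apply lsum_ext. intros u _.
  unfold M. rewrite <- lsum_conj, <- !lsum_mult. apply lsum_ext. intros v _.
  rewrite tri_form_eq, Cmult_conj. ring.
- apply lsum_ext. intros u Hu. apply lsum_ext. intros v Hv.
  apply in_seq in Hu, Hv. rewrite HD by lia.
  now rewrite lsum_mult_r, lsum_mult.
Qed.

Lemma lsum_nth_0 {A : Type} (f : A -> CC) (l : list A) :
  (forall k s, nth_error l k = Some s -> f s = RtoC 0) -> lsum f l = RtoC 0.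
Proof.
intros H. apply lsum_0. intros t Ht. destruct (In_nth_error _ _ Ht) as [k Hk].
now apply (H k).
Qed.

(** Terms are singled out by position because disjointness of interiors is stated for distinct
    positions of the list; this also excludes counting a triangle twice. *)
Lemma lsum_nth_one {A : Type} (f : A -> CC) (l : list A) (i : nat) (t : A) :
  nth_error l i = Some t ->
  (forall k s, nth_error l k = Some s -> k <> i -> f s = RtoC 0) -> lsum f l = f t.
Proof.
revert i. induction l as [|a l IH]; intros [|i] Hi H; try discriminate; simpl in *.
- injection Hi as ->. rewrite lsum_nth_0, Cplus_0_r; [reflexivity|].
  intros k s Hk. now apply (H (S k)).
- rewrite (H 0%nat a), Cplus_0_l by easy. apply (IH i); [exact Hi|].
  intros k s Hk Hki. apply (H (S k)); [exact Hk|lia].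
Qed.

Lemma lsum_nth_two {A : Type} (f : A -> CC) (l : list A) (i j : nat) (t s : A) :
  nth_error l i = Some t -> nth_error l j = Some s -> i <> j ->
  (forall k r, nth_error l k = Some r -> k <> i -> k <> j -> f r = RtoC 0) ->
  lsum f l = Cplus (f t) (f s).
Proof.
revert i j. induction l as [|a l IH]; intros [|i] [|j] Hi Hj Hij H; try discriminate;
  try lia; simpl in *.
- injection Hi as ->. rewrite (lsum_nth_one f l j s Hj); [reflexivity|].
  intros k r Hk Hkj. apply (H (S k)); [exact Hk|lia|lia].
- injection Hj as ->. rewrite Cplus_comm. f_equal. apply (lsum_nth_one f l i t Hi).
  intros k r Hk Hkj. apply (H (S k)); [exact Hk|lia|lia].
- rewrite (H 0%nat a), Cplus_0_l by easy. apply (IH i j); [exact Hi|exact Hj|lia|].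
  intros k r Hk Hki Hkj. apply (H (S k)); [exact Hk|lia|lia].
Qed.

(** * Germs of arcs at a vertex *)

Lemma pos_near (a b c : R) : 0 < a ->
  exists e, 0 < e /\ forall d, 0 < d < e -> 0 < a + b * d + c * d ^ 2.
Proof.
intros Ha. set (m := Rabs b + Rabs c + 1).
assert (Hb := Rabs_pos b). assert (Hc := Rabs_pos c).
assert (Hm : 0 < m) by (unfold m; lra).
(* For d <= 1 the square of d is at most d, so the perturbation is at most d (|b| + |c|). *)
exists (Rmin 1 (a / m)). split.
{ apply Rmin_glb_lt; [lra|]. now apply Rdiv_lt_0_compat. }
intros d [Hd0 Hd]. assert (H1 := Rmin_l 1 (a / m)). assert (H2 := Rmin_r 1 (a / m)).
assert (Hdm : d * m < a).
{ apply Rlt_le_trans with (a / m * m); [apply Rmult_lt_compat_r; lra|].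
  right; field; lra. }
assert (- Rabs b * d <= b * d).
{ apply Rmult_le_compat_r; [lra|]. generalize (Rle_abs (- b)). rewrite Rabs_Ropp. lra. }
assert (- Rabs c * d ^ 2 <= c * d ^ 2).
{ apply Rmult_le_compat_r; [apply pow2_ge_0|].
  generalize (Rle_abs (- c)). rewrite Rabs_Ropp. lra. }
assert (Rabs c * d ^ 2 <= Rabs c * d) by (apply Rmult_le_compat_l; nra).
unfold m in Hdm. nra.
Qed.

Lemma inf_often_nonneg (a b c : R) :
  (forall e, 0 < e -> exists d, 0 < d < e /\ 0 <= a + b * d + c * d ^ 2) -> 0 <= a.
Proof.
intros H. destruct (Rle_dec 0 a) as [|n]; [assumption|].
destruct (pos_near (- a) (- b) (- c)) as (e & He & Hd); [lra|].
destruct (H e He) as (d & Hd1 & Hd2). specialize (Hd d Hd1). lra.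
Qed.

Lemma inf_often_nonneg_next (b c : R) :
  (forall e, 0 < e -> exists d, 0 < d < e /\ 0 <= 0 + b * d + c * d ^ 2) -> 0 <= b.
Proof.
intros H. apply (inf_often_nonneg b c 0). intros e He.
destruct (H e He) as (d & Hd & Hp). exists d. split; [exact Hd|].
apply Rmult_le_reg_l with d; [apply Hd|]. nra.
Qed.

(** In a finite list one member must recur for arbitrarily small d; the triangle met by an arc can
    thus be chosen independently of d. *)
Lemma pigeonhole {A : Type} (T : list A) (Q : A -> R -> Prop) :
  (exists e, 0 < e /\ forall d, 0 < d < e -> exists t, In t T /\ Q t d) ->
  exists t, In t T /\ forall e, 0 < e -> exists d, 0 < d < e /\ Q t d.
Proof.
induction T as [|a T IH]; intros (e & He & H).
{ destruct (H (e / 2)) as (t & [] & _). lra. }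
destruct (classic (forall e', 0 < e' -> exists d, 0 < d < e' /\ Q a d)) as [Ha|Ha].
{ exists a. split; [now left|exact Ha]. }
apply not_all_ex_not in Ha. destruct Ha as [e' Ha].
apply imply_to_and in Ha. destruct Ha as [He' Ha].
destruct IH as (t & Ht & HQ).
- exists (Rmin e e'). split; [now apply Rmin_glb_lt|]. intros d Hd.
  assert (H1 := Rmin_l e e'). assert (H2 := Rmin_r e e').
  destruct (H d) as (t & [<-|Ht] & HQ); [lra| |now exists t].
  elim Ha. exists d. split; [lra|exact HQ].
- exists t. split; [now right|exact HQ].
Qed.

(* Leaves u in direction v, bending to the left if sg = 1 and to the right if sg = -1. *)
Definition arc (sg : R) (u v : CC) (d : R) : CC :=
  (fst u + d * fst v - sg * d ^ 2 * snd v, snd u + d * snd v + sg * d ^ 2 * fst v).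

Lemma orient_arc (sg : R) (a b u v : CC) (d : R) :
  orient a b (arc sg u v d) =
  orient a b u + cross (Cminus b a) v * d + (sg * dot (Cminus b a) v) * d ^ 2.
Proof. unfold orient, arc, cross, dot; simpl. ring. Qed.

(* The arc leaving 0 in direction v starts inside the angular sector from b to c. *)
Definition incone (sg : R) (b c v : CC) : Prop :=
  (0 <= cross b v /\ (cross b v = 0 -> 0 < sg * dot b v)) /\
  (0 <= cross v c /\ (cross v c = 0 -> 0 < - (sg * dot v c))).

(** By Lagrange's identity the cross and dot products cannot vanish together; hence the quadratic
    coefficient along an arc decides when the linear one is 0. *)
Lemma cross_dot_0 (b v : CC) : cross b v = 0 -> dot b v = 0 -> 0 < nsq b -> 0 < nsq v -> False.
Proof.
intros H1 H2 Hb Hv. assert (0 < nsq b * nsq v) by now apply Rmult_lt_0_compat.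
assert (nsq b * nsq v = cross b v ^ 2 + dot b v ^ 2) by (unfold nsq, cross, dot; ring).
rewrite H1, H2 in H0. lra.
Qed.

Definition corner (t : tri) (u q r : nat) : Prop :=
  t = (u, q, r) \/ t = (r, u, q) \/ t = (q, r, u).

Lemma corner_closed (P : nat -> CC) (t : tri) (u q r : nat) (p : CC) : corner t u q r ->
  t_closed P t p <->
  (0 <= orient (P u) (P q) p /\ 0 <= orient (P q) (P r) p /\ 0 <= orient (P r) (P u) p).
Proof. intros [-> | [-> | ->]]; simpl; tauto. Qed.

Lemma corner_open (P : nat -> CC) (t : tri) (u q r : nat) (p : CC) : corner t u q r ->
  t_open P t p <->
  (0 < orient (P u) (P q) p /\ 0 < orient (P q) (P r) p /\ 0 < orient (P r) (P u) p).
Proof. intros [-> | [-> | ->]]; simpl; tauto. Qed.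

Lemma corner_vertex (t : tri) (u q r k : nat) : corner t u q r ->
  t_has_vertex t k <-> (k = u \/ k = q \/ k = r).
Proof. intros [-> | [-> | ->]]; simpl; tauto. Qed.

Lemma vertex_corner (t : tri) (u : nat) : t_has_vertex t u -> exists q r, corner t u q r.
Proof.
destruct t as [[a b] c]. unfold corner. intros [-> | [-> | ->]].
- exists b, c. now left.
- exists c, a. now right; left.
- exists a, b. now right; right.
Qed.

Lemma pos_or_next_near (a b : R) : 0 <= a -> (a = 0 -> 0 < b) ->
  exists e, 0 < e /\ forall d, 0 < d < e -> 0 < a + b * d.
Proof.
intros Ha Hb. destruct (Req_dec a 0) as [->|n].
- exists 1. split; [lra|]. intros d Hd. rewrite Rplus_0_l.
  apply Rmult_lt_0_compat; [now apply Hb|apply Hd].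
- destruct (pos_near a b 0) as (e & He & H); [lra|]. exists e. split; [exact He|].
  intros d Hd. specialize (H d Hd). lra.
Qed.

Lemma convex_orient (a b p q : CC) (l : R) : 0 <= l <= 1 ->
  0 <= orient a b p -> 0 <= orient a b q ->
  0 <= orient a b (fst p + l * (fst q - fst p), snd p + l * (snd q - snd p)).
Proof.
intros Hl Hp Hq.
replace (orient a b _) with ((1 - l) * orient a b p + l * orient a b q)
  by (unfold orient; simpl; ring).
apply Rplus_le_le_0_compat; apply Rmult_le_pos; lra.
Qed.

Lemma closed_convex (P : nat -> CC) (t : tri) (p q : CC) (l : R) : 0 <= l <= 1 ->
  t_closed P t p -> t_closed P t q ->
  t_closed P t (fst p + l * (fst q - fst p), snd p + l * (snd q - snd p)).
Proof.
destruct t as [[a b] c]. intros Hl (H1 & H2 & H3) (H4 & H5 & H6).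
repeat split; now apply convex_orient.
Qed.

(** * Angles under which a segment is seen *)

(** The cosine of the angle at p times the distances from p to a and b; [orient a b p] is the sine
    times the same product. On the line ab the sign is negative exactly strictly between a and b. *)
Definition chord_dot (a b p : CC) : R := dot (Cminus a p) (Cminus b p).

Definition cosine (X S : R) : R := X / sqrt (X ^ 2 + S ^ 2).

(* The cosine of the angle at p of the triangle (a, b, p) if p is on the left of ab; the
   value 1 for p on the right is neutral in the minimum [opposite_cos]. *)
Definition left_cos (a b p : CC) : R :=
  if Rle_dec 0 (orient a b p) then cosine (chord_dot a b p) (orient a b p) else 1.

Lemma orient_swap (a b p : CC) : orient b a p = - orient a b p.
Proof. unfold orient; ring. Qed.

Lemma chord_dot_swap (a b p : CC) : chord_dot b a p = chord_dot a b p.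
Proof. unfold chord_dot, dot; ring. Qed.

Lemma chord_norm (a b p : CC) :
  chord_dot a b p ^ 2 + orient a b p ^ 2 = nsq (Cminus a p) * nsq (Cminus b p).
Proof. unfold chord_dot, orient, nsq, dot; simpl. ring. Qed.

Lemma cosine_opp (X S : R) : cosine (- X) S = - cosine X S.
Proof.
unfold cosine. replace ((- X) ^ 2) with (X ^ 2) by ring. unfold Rdiv; ring.
Qed.

Lemma cosine_sqr (X S : R) : 0 < X ^ 2 + S ^ 2 ->
  1 - cosine X S ^ 2 = S ^ 2 / (X ^ 2 + S ^ 2).
Proof.
intros H. unfold cosine. unfold Rdiv at 1. rewrite Rpow_mult_distr, pow_inv, pow2_sqrt by lra.
field. lra.
Qed.

Lemma cosine_sine (X S : R) : 0 <= S -> 0 < X ^ 2 + S ^ 2 ->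
  sqrt (1 - cosine X S ^ 2) = S / sqrt (X ^ 2 + S ^ 2).
Proof.
intros HS H. rewrite cosine_sqr by assumption.
rewrite sqrt_div_alt by assumption. now rewrite sqrt_pow2.
Qed.

Lemma cosine_le_1 (X S : R) : 0 < X ^ 2 + S ^ 2 -> cosine X S <= 1.
Proof.
intros H. assert (E := cosine_sqr X S H).
assert (0 <= S ^ 2 / (X ^ 2 + S ^ 2)).
{ apply Rdiv_le_0_compat; [apply pow2_ge_0|assumption]. }
nra.
Qed.

(** The last hypothesis compares the arguments of X1 + i S1 and X + i S, both in the closed upper
    half-plane, by a cross product; the cosine decreases on [0, PI]. *)
Lemma cosine_mono (X1 S1 X S : R) : 0 < S1 -> 0 <= S -> 0 < X ^ 2 + S ^ 2 ->
  X1 * S <= X * S1 -> cosine X1 S1 <= cosine X S.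
Proof.
intros HS1 HS HX H.
assert (HX1 : 0 < X1 ^ 2 + S1 ^ 2) by (assert (0 <= X1 ^ 2) by apply pow2_ge_0; nra).
assert (E1 := cosine_sqr X1 S1 HX1). assert (E := cosine_sqr X S HX).
assert (G1 := cosine_sine X1 S1 (Rlt_le _ _ HS1) HX1). assert (G := cosine_sine X S HS HX).
assert (R1 : 0 < sqrt (X1 ^ 2 + S1 ^ 2)) by now apply sqrt_lt_R0.
assert (R : 0 < sqrt (X ^ 2 + S ^ 2)) by now apply sqrt_lt_R0.
set (c1 := cosine X1 S1) in *. set (c := cosine X S) in *.
set (s1 := S1 / sqrt (X1 ^ 2 + S1 ^ 2)) in *. set (s := S / sqrt (X ^ 2 + S ^ 2)) in *.
assert (Hs1 : 0 < s1) by now apply Rdiv_lt_0_compat.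
assert (Hs : 0 <= s) by now apply Rdiv_le_0_compat.
assert (Q1 : c1 ^ 2 + s1 ^ 2 = 1).
{ assert (s1 ^ 2 = S1 ^ 2 / (X1 ^ 2 + S1 ^ 2)); [|lra].
  unfold s1, Rdiv. rewrite Rpow_mult_distr, pow_inv, pow2_sqrt by lra. reflexivity. }
assert (Q : c ^ 2 + s ^ 2 = 1).
{ assert (s ^ 2 = S ^ 2 / (X ^ 2 + S ^ 2)); [|lra].
  unfold s, Rdiv. rewrite Rpow_mult_distr, pow_inv, pow2_sqrt by lra. reflexivity. }
assert (Hcs : c1 * s <= c * s1).
{ unfold c1, s, c, s1, cosine.
  apply Rmult_le_reg_r with (sqrt (X1 ^ 2 + S1 ^ 2) * sqrt (X ^ 2 + S ^ 2));
    [now apply Rmult_lt_0_compat|].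
  replace (_ * _ * _) with (X1 * S) by (field; lra).
  replace (_ * _ * _) with (X * S1) by (field; lra). exact H. }
clearbody c1 c s1 s. clear - Hs1 Hs Q1 Q Hcs.
destruct (Rle_dec c1 c) as [|n]; [assumption|]. exfalso.
assert (Hlt : c < c1) by lra.
destruct (Rle_dec 0 c) as [Hc|Hc].
- assert ((c1 * s) ^ 2 <= (c * s1) ^ 2).
  { apply pow_incr. split; [|assumption]. apply Rmult_le_pos; lra. }
  nra.
- destruct (Rle_dec 0 c1) as [Hc1|Hc1].
  + assert (0 <= c1 * s) by now apply Rmult_le_pos. nra.
  + assert ((- c * s1) ^ 2 <= (- c1 * s) ^ 2).
    { apply pow_incr. split; [|lra]. apply Rmult_le_pos; lra. }
    nra.
Qed.

(** * The form of an edge in terms of the two extremal angles *)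

(** The initial value 1 is neutral for cosines; it corresponds to the angle 0 when there is no point
    to look from. *)
Definition rmin (f : nat -> R) (l : list nat) : R :=
  fold_right (fun k acc => Rmin (f k) acc) 1 l.

Lemma rmin_le (f : nat -> R) (l : list nat) (k : nat) : In k l -> rmin f l <= f k.
Proof.
induction l as [|a l IH]; intros [].
- subst a. apply Rmin_l.
- apply Rle_trans with (1 := Rmin_r _ _). now apply IH.
Qed.

Lemma rmin_eq (f : nat -> R) (l : list nat) (k : nat) :
  In k l -> f k <= 1 -> (forall j, In j l -> f k <= f j) -> rmin f l = f k.
Proof.
intros Hk H1 H. apply Rle_antisym; [now apply rmin_le|]. clear Hk.
induction l as [|a l IH]; [exact H1|]. simpl. apply Rmin_glb.
- apply H; now left.
- apply IH. intros j Hj. apply H; now right.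
Qed.

Definition others (N u w : nat) : list nat :=
  filter (fun k => negb (Nat.eqb k u || Nat.eqb k w)) (seq 1 (N + 3)).

Lemma in_others (N u w k : nat) : In k (others N u w) <-> idx N k /\ k <> u /\ k <> w.
Proof.
unfold others. rewrite filter_In, in_seq, Bool.negb_true_iff, Bool.orb_false_iff,
  !Nat.eqb_neq. unfold idx. lia.
Qed.

Definition opposite_cos (N : nat) (P : nat -> CC) (u w : nat) : R :=
  rmin (fun k => left_cos (P u) (P w) (P k)) (others N u w).

(* For p = cos a and q = cos b this is sin (a + b) e^(i (a - b)) if a + b <= PI, and 0
   otherwise. *)
Definition edge_coef (p q : R) : CC :=
  (p * sqrt (1 - p ^ 2) + Rmax q (- p) * sqrt (1 - Rmax q (- p) ^ 2), Rmax q (- p) ^ 2 - p ^ 2).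

Definition edge_form (N : nat) (P : nat -> CC) (u w : nat) : CC :=
  Cmult (RtoC (- / (2 * nsq (Cminus (P u) (P w)))))
        (edge_coef (opposite_cos N P u w) (opposite_cos N P w u)).

(** [Rmax q (- p)] replaces the angle b by the smaller of b and PI - a. The coefficient vanishes at
    a + b = PI, which makes the truncation continuous. *)
Lemma edge_coef_0 (p q : R) : p + q <= 0 -> edge_coef p q = RtoC 0.
Proof.
intros H. unfold edge_coef. rewrite Rmax_right by lra.
replace ((- p) ^ 2) with (p ^ 2) by ring. unfold RtoC. f_equal; ring.
Qed.

(** * Contribution of one triangle to one edge *)

Lemma kron_same (k : nat) : kron k k = 1.
Proof. unfold kron. now rewrite Nat.eqb_refl. Qed.

Lemma kron_other (k u : nat) : k <> u -> kron k u = 0.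
Proof. intros H. unfold kron. now rewrite (proj2 (Nat.eqb_neq k u) H). Qed.

Lemma corner_vec (P : nat -> CC) (t : tri) (u q r : nat) : corner t u q r ->
  u <> q -> u <> r -> tri_vec P t u = Cminus (P r) (P q).
Proof.
intros [-> | [-> | ->]] H1 H2; unfold tri_vec, vel1, vel2, edge1, edge2;
  rewrite kron_same, !kron_other by congruence;
  unfold rscale, Cminus, Cplus, Copp; simpl; f_equal; ring.
Qed.

Lemma corner_weight (P : nat -> CC) (t : tri) (u q r : nat) : corner t u q r ->
  tri_weight P t = orient (P u) (P q) (P r)
   / (2 * nsq (Cminus (P u) (P q)) * nsq (Cminus (P u) (P r)) * nsq (Cminus (P q) (P r))).
Proof.
assert (A : forall b c, nsq (Cminus b c) = nsq (Cminus c b)) by (intros; unfold nsq; simpl; ring).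
assert (B : forall a b c, nsq (Cminus (Cminus b a) (Cminus c a)) = nsq (Cminus b c))
  by (intros; unfold nsq; simpl; ring).
intros [-> | [-> | ->]]; unfold tri_weight, edge1, edge2; rewrite B;
unfold Rdiv; f_equal; try (unfold cross, orient; simpl; ring); f_equal.
- rewrite (A (P q) (P u)), (A (P r) (P u)). ring.
- rewrite (A (P u) (P r)), (A (P q) (P r)). ring.
- rewrite (A (P r) (P q)), (A (P r) (P u)). ring.
Qed.

Lemma tri_form_absent (P : nat -> CC) (t : tri) (u w : nat) :
  ~ (t_has_vertex t u /\ t_has_vertex t w) -> tri_form P u w t = RtoC 0.
Proof.
intros H. rewrite tri_form_eq.
assert (V : forall k, ~ t_has_vertex t k -> tri_vec P t k = RtoC 0).
{ intros k Hk. destruct t as [[a b] c]. simpl in Hk.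
  unfold tri_vec, vel1, vel2. rewrite !kron_other by (intros E; apply Hk; subst; tauto).
  unfold rscale, Cminus, Cplus, Copp, RtoC; simpl. f_equal; ring. }
destruct (classic (t_has_vertex t u)) as [Hu|Hu].
- rewrite (V w) by tauto. unfold Cmult, Cconj, RtoC; simpl. f_equal; ring.
- rewrite (V u) by tauto. unfold Cmult, Cconj, RtoC; simpl. f_equal; ring.
Qed.

Lemma left_cos_pos (a b p : CC) : 0 <= orient a b p ->
  left_cos a b p = cosine (chord_dot a b p) (orient a b p).
Proof. intros H. unfold left_cos. destruct (Rle_dec 0 (orient a b p)); [reflexivity|tauto]. Qed.

Lemma cosine_form (X S : R) : 0 < S ->
  cosine X S * sqrt (1 - cosine X S ^ 2) = X * S / (X ^ 2 + S ^ 2).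
Proof.
intros HS. assert (H : 0 < X ^ 2 + S ^ 2) by (assert (0 <= X ^ 2) by apply pow2_ge_0; nra).
rewrite cosine_sine by lra. unfold cosine.
assert (Hs := sqrt_lt_R0 _ H). assert (E := pow2_sqrt (X ^ 2 + S ^ 2) (Rlt_le _ _ H)).
rewrite <- E at 3. field. lra.
Qed.

(** Let X + i S be P w - P r times the conjugate of P u - P r. The vectors of t at u and w
    contribute - (X + i S), and X^2 + S^2 is the product of two of the squared sides in the weight,
    so only the angle at r and |u - w| remain. *)
Lemma tri_form_left (P : nat -> CC) (t : tri) (u w r : nat) : corner t u w r ->
  u <> w -> u <> r -> w <> r -> 0 < orient (P u) (P w) (P r) ->
  let c := left_cos (P u) (P w) (P r) in
  tri_form P u w t = Cmult (RtoC (- / (2 * nsq (Cminus (P u) (P w)))))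
                           (c * sqrt (1 - c ^ 2), 1 - c ^ 2).
Proof.
intros Hc H1 H2 H3 Ho c.
assert (Hc' : corner t w r u) by (unfold corner in *; tauto).
rewrite tri_form_eq, (corner_vec P t u w r), (corner_vec P t w r u), (corner_weight P t u w r)
  by congruence.
unfold c. rewrite left_cos_pos by lra. rewrite cosine_form by lra.
assert (Hx : 0 < chord_dot (P u) (P w) (P r) ^ 2 + orient (P u) (P w) (P r) ^ 2)
  by (assert (H := pow2_ge_0 (chord_dot (P u) (P w) (P r))); nra).
rewrite cosine_sqr by assumption. rewrite chord_norm in *.
assert (Hn : 0 < nsq (Cminus (P u) (P w))).
{ destruct (nsq_pos_cross (Cminus (P w) (P u)) (Cminus (P r) (P u)) Ho) as (H & _).
  replace (nsq _) with (nsq (Cminus (P w) (P u))) by (unfold nsq; simpl; ring). exact H. }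
assert (Hn1 : nsq (Cminus (P u) (P r)) <> 0) by (intros E; rewrite E in Hx; lra).
assert (Hn2 : nsq (Cminus (P w) (P r)) <> 0) by (intros E; rewrite E in Hx; lra).
set (n0 := nsq (Cminus (P u) (P w))) in *. set (n1 := nsq (Cminus (P u) (P r))) in *.
set (n2 := nsq (Cminus (P w) (P r))) in *.
clearbody n0 n1 n2. unfold chord_dot, dot, orient in *.
unfold Cmult, Cconj, RtoC, Cminus, Cplus, Copp; simpl. f_equal; field; repeat split; lra.
Qed.

(** The form is Hermitian, so this is the conjugate of the left case with u and w exchanged. *)
Lemma tri_form_right (P : nat -> CC) (t : tri) (u w r : nat) : corner t u r w ->
  u <> w -> u <> r -> w <> r -> 0 < orient (P w) (P u) (P r) ->
  let c := left_cos (P w) (P u) (P r) in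
  tri_form P u w t = Cmult (RtoC (- / (2 * nsq (Cminus (P u) (P w)))))
                           (c * sqrt (1 - c ^ 2), c ^ 2 - 1).
Proof.
intros Hc H1 H2 H3 Ho c.
assert (Hc' : corner t w u r) by (unfold corner in *; tauto).
assert (Hl : tri_form P w u t = Cmult (RtoC (- / (2 * nsq (Cminus (P w) (P u)))))
                           (c * sqrt (1 - c ^ 2), 1 - c ^ 2)).
{ apply tri_form_left; auto. }
replace (tri_form P u w t) with (Cconj (tri_form P w u t)).
- rewrite Hl. replace (nsq (Cminus (P u) (P w))) with (nsq (Cminus (P w) (P u)))
    by (unfold nsq; simpl; ring).
  unfold Cconj, Cmult, RtoC; simpl. f_equal; ring.
- rewrite !tri_form_eq. unfold Cconj, Cmult, RtoC; simpl. f_equal; ring.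
Qed.

(** The sign of l^2 - l separates the points strictly between a and b from the other points of the
    line. *)
Lemma collinear_param (a b p : CC) : 0 < nsq (Cminus b a) ->
  cross (Cminus p a) (Cminus b a) = 0 ->
  let l := dot (Cminus p a) (Cminus b a) / nsq (Cminus b a) in
  p = (fst a + l * (fst b - fst a), snd a + l * (snd b - snd a)) /\
  chord_dot a b p = (l ^ 2 - l) * nsq (Cminus b a).
Proof.
intros Hn Hc l.
assert (E : p = (fst a + l * (fst b - fst a), snd a + l * (snd b - snd a))).
{ unfold l. destruct a as [a1 a2], b as [b1 b2], p as [p1 p2].
  unfold dot, cross, nsq, Cminus, Cplus, Copp in *; simpl fst in *; simpl snd in *.
  f_equal.
  - apply Rmult_eq_reg_r with ((b1 + - a1) ^ 2 + (b2 + - a2) ^ 2); [|lra].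
    field_simplify; [|lra].
    apply Rminus_diag_uniq.
    transitivity ((b2 - a2) * ((p1 + - a1) * (b2 + - a2) - (p2 + - a2) * (b1 + - a1))); [ring|].
    rewrite Hc; ring.
  - apply Rmult_eq_reg_r with ((b1 + - a1) ^ 2 + (b2 + - a2) ^ 2); [|lra].
    field_simplify; [|lra].
    apply Rminus_diag_uniq.
    transitivity (- (b1 - a1) * ((p1 + - a1) * (b2 + - a2) - (p2 + - a2) * (b1 + - a1))); [ring|].
    rewrite Hc; ring. }
split; [exact E|].
clearbody l. rewrite E. unfold chord_dot, dot, nsq; simpl. ring.
Qed.

(* [orient a b c] times the power of p with respect to the circle through a, b, c. *)
Definition incircle (a b c p : CC) : R :=
  chord_dot a b p * orient a b c - chord_dot a b c * orient a b p.

Lemma incircle_rotate (a b c p : CC) : incircle a b c p = incircle b c a p.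
Proof. unfold incircle, chord_dot, orient, dot; simpl. ring. Qed.

Lemma incircle_circumcenter (a b c : CC) : 0 < orient a b c ->
  exists o, Cmod (Cminus a o) = Cmod (Cminus b o) /\
    Cmod (Cminus a o) = Cmod (Cminus c o) /\
    forall p, Cmod (Cminus a o) <= Cmod (Cminus p o) -> 0 <= incircle a b c p.
Proof.
intros H.
(* The circumcenter, by Cramer's rule from the perpendicular bisectors of ab and ac. *)
set (o := (fst a + ((snd c - snd a) * nsq (Cminus b a) - (snd b - snd a) * nsq (Cminus c a))
             / (2 * orient a b c),
           snd a + ((fst b - fst a) * nsq (Cminus c a) - (fst c - fst a) * nsq (Cminus b a))
             / (2 * orient a b c)) : CC).
assert (E : forall p, orient a b c * (nsq (Cminus p o) - nsq (Cminus a o)) = incircle a b c p).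
{ intros p. unfold o, incircle, chord_dot, dot, nsq, orient in *; simpl. field. lra. }
assert (M : forall p, Cmod p = sqrt (nsq p)) by reflexivity.
assert (Z : forall p, incircle a b c p = 0 -> Cmod (Cminus a o) = Cmod (Cminus p o)).
{ intros p Hp. rewrite !M. f_equal. rewrite <- E in Hp. apply Rmult_integral in Hp. lra. }
exists o. split; [|split].
- apply Z. unfold incircle, chord_dot, orient, dot; simpl; ring.
- apply Z. unfold incircle; ring.
- intros p Hp. rewrite <- E. apply Rmult_le_pos; [lra|]. rewrite !M in Hp.
  assert (P0 : forall q, 0 <= nsq q)
    by (intros q; unfold nsq; apply Rplus_le_le_0_compat; apply pow2_ge_0).
  apply sqrt_le_0 in Hp; [lra| |]; apply P0.
Qed.

(** * Delaunay triangles around an interior vertex *)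

Section Delaunay.
Variables (N : nat) (z1 z2 z3 : CC) (z : nat -> CC) (T : list tri).
Local Notation P := (pts z1 z2 z3 z).
Hypothesis Hadm : admissible N z1 z2 z3 z.
Hypothesis HT : is_delaunay N z1 z2 z3 z T.

Lemma tri_facts (t : tri) (u q r : nat) : In t T -> corner t u q r ->
  idx N u /\ idx N q /\ idx N r /\ 0 < orient (P u) (P q) (P r).
Proof.
intros Ht Hc. destruct HT as [(H & _) _]. specialize (H t Ht).
assert (R1 : forall a b c, orient a b c = orient b c a) by (intros; unfold orient; ring).
destruct Hc as [-> | [-> | ->]]; destruct H as (H1 & H2 & H3 & H4).
- tauto.
- rewrite <- R1. tauto.
- rewrite R1. tauto.
Qed.

Lemma orient_degenerate (a b : CC) :
  orient a a b = 0 /\ orient a b b = 0 /\ orient a b a = 0.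
Proof. unfold orient; repeat split; ring. Qed.

Lemma corner_distinct (t : tri) (u q r : nat) : In t T -> corner t u q r ->
  u <> q /\ u <> r /\ q <> r.
Proof.
intros Ht Hc. destruct (tri_facts t u q r Ht Hc) as (_ & _ & _ & H).
repeat split; intros E; rewrite E in H; unfold orient in H; lra.
Qed.

Lemma corner_unique (t : tri) (u q r q' r' : nat) : In t T ->
  corner t u q r -> corner t u q' r' -> q = q' /\ r = r'.
Proof.
intros Ht H1 H2. assert (D1 := corner_distinct t u q r Ht H1).
destruct H1 as [-> | [-> | ->]]; destruct H2 as [E | [E | E]]; injection E; intros;
  intuition congruence.
Qed.

Lemma nsq_pos_neq (a b : CC) : a <> b -> 0 < nsq (Cminus a b).
Proof.
intros H. destruct a as [a1 a2], b as [b1 b2].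
unfold nsq, Cminus, Cplus, Copp; simpl fst; simpl snd.
assert (H1 := pow2_ge_0 (a1 + - b1)). assert (H2 := pow2_ge_0 (a2 + - b2)).
destruct (Req_dec a1 b1) as [->|n1]; [destruct (Req_dec a2 b2) as [->|n2]; [tauto|]|].
- assert (0 < (a2 + - b2) ^ 2) by (apply pow2_gt_0; lra). lra.
- assert (0 < (a1 + - b1) ^ 2) by (apply pow2_gt_0; lra). lra.
Qed.

Lemma nsq_pos_idx (a b : nat) : idx N a -> idx N b -> a <> b -> 0 < nsq (Cminus (P a) (P b)).
Proof.
intros Ha Hb Hab. apply nsq_pos_neq. destruct Hadm as [_ H]. now apply H.
Qed.

(** As u is interior to the outer triangle, the arc stays in it for small d and is covered; one
    triangle t meets it at arbitrarily small d. Letting d tend to 0 puts P u into t, so u is a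
    vertex of t, and the leading coefficients of the orientations along the arc give the cone. *)
Lemma exists_cone (sg : R) (u : nat) (v : CC) : sg <> 0 -> cidx N u -> 0 < nsq v ->
  exists t q r, In t T /\ corner t u q r /\
    incone sg (Cminus (P q) (P u)) (Cminus (P r) (P u)) v.
Proof.
intros Hsg Hu Hv.
assert (Hu' : idx N u) by (unfold cidx, idx in *; lia).
assert (EP : P u = z u) by (destruct u as [|[|[|[|u]]]]; unfold cidx in Hu; try lia; reflexivity).
destruct HT as [(_ & _ & Hcov & _ & Hemp) _].
destruct (pigeonhole T (fun t d => t_closed P t (arc sg (P u) v d))) as (t & Ht & HQ).
{ destruct (proj1 Hadm u Hu) as (I1 & I2 & I3). rewrite <- EP in I1, I2, I3.
  destruct (pos_near _ (cross (Cminus z2 z1) v * orient z1 z2 z3)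
    (sg * dot (Cminus z2 z1) v * orient z1 z2 z3) I1) as (e1 & He1 & H1).
  destruct (pos_near _ (cross (Cminus z3 z2) v * orient z2 z3 z1)
    (sg * dot (Cminus z3 z2) v * orient z2 z3 z1) I2) as (e2 & He2 & H2).
  destruct (pos_near _ (cross (Cminus z1 z3) v * orient z3 z1 z2)
    (sg * dot (Cminus z1 z3) v * orient z3 z1 z2) I3) as (e3 & He3 & H3).
  exists (Rmin e1 (Rmin e2 e3)). split; [now repeat apply Rmin_glb_lt|].
  intros d [Hd0 Hd]. apply Hcov. unfold in_closed_tri. rewrite !orient_arc.
  assert (M1 := Rmin_l e1 (Rmin e2 e3)). assert (M2 := Rmin_r e1 (Rmin e2 e3)).
  assert (M3 := Rmin_l e2 e3). assert (M4 := Rmin_r e2 e3).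
  specialize (H1 d). specialize (H2 d). specialize (H3 d).
  repeat split.
  - apply Rlt_le. eapply Rlt_le_trans; [apply H1; lra|]. right; ring.
  - apply Rlt_le. eapply Rlt_le_trans; [apply H2; lra|]. right; ring.
  - apply Rlt_le. eapply Rlt_le_trans; [apply H3; lra|]. right; ring. }
assert (Hlim : forall a b, (forall d, t_closed P t (arc sg (P u) v d) ->
    0 <= orient a b (arc sg (P u) v d)) -> 0 <= orient a b (P u)).
{ intros a b H. apply (inf_often_nonneg _ (cross (Cminus b a) v) (sg * dot (Cminus b a) v)).
  intros e He. destruct (HQ e He) as (d & Hd & Hc). exists d. split; [exact Hd|].
  rewrite <- orient_arc. now apply H. }
assert (Hvert : t_has_vertex t u).
{ apply Hemp; [exact Ht|exact Hu'|]. destruct t as [[a b] c].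
  repeat split; apply Hlim; intros d Hd; apply Hd. }
destruct (vertex_corner t u Hvert) as (q & r & Hc).
exists t, q, r. split; [exact Ht|]. split; [exact Hc|].
destruct (tri_facts t u q r Ht Hc) as (_ & Hq & Hr & Hor).
destruct (corner_distinct t u q r Ht Hc) as (Duq & Dur & Dqr).
(* On the two sides of t through u the constant coefficient is 0, so the linear one, and after it
   the quadratic one, must be nonnegative. *)
assert (Hlim2 : forall a b, orient a b (P u) = 0 ->
    (forall d, t_closed P t (arc sg (P u) v d) -> 0 <= orient a b (arc sg (P u) v d)) ->
    0 <= cross (Cminus b a) v /\ (cross (Cminus b a) v = 0 -> 0 <= sg * dot (Cminus b a) v)).
{ intros a b H0 H.
  assert (Hs : forall e, 0 < e -> exists d, 0 < d < e /\
    0 <= 0 + cross (Cminus b a) v * d + (sg * dot (Cminus b a) v) * d ^ 2).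
  { intros e He. destruct (HQ e He) as (d & Hd & Hcl). exists d. split; [exact Hd|].
    assert (K := H d Hcl). now rewrite orient_arc, H0 in K. }
  split; [now apply inf_often_nonneg_next with (1 := Hs)|].
  intros E. rewrite E in Hs. apply (inf_often_nonneg _ 0 0). intros e He.
  destruct (Hs e He) as (d & Hd & Hp). exists d. split; [exact Hd|].
  assert (0 < d ^ 2) by (apply pow2_gt_0; lra).
  apply Rmult_le_reg_r with (d ^ 2); [assumption|]. lra. }
assert (Hstrict : forall b, 0 < nsq b -> cross b v = 0 -> 0 <= sg * dot b v -> 0 < sg * dot b v).
{ intros b Hb E [H|H]; [exact H|]. exfalso.
  symmetry in H. apply Rmult_integral in H. destruct H as [H|H]; [tauto|].
  now apply (cross_dot_0 b v). }
destruct (Hlim2 (P u) (P q)) as [A1 A2].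
{ apply orient_degenerate. }
{ intros d Hd. now apply (proj1 (corner_closed P t u q r _ Hc)) in Hd. }
destruct (Hlim2 (P r) (P u)) as [B1 B2].
{ apply orient_degenerate. }
{ intros d Hd. now apply (proj1 (corner_closed P t u q r _ Hc)) in Hd. }
assert (F1 : cross v (Cminus (P r) (P u)) = cross (Cminus (P u) (P r)) v)
  by (unfold cross; simpl; ring).
assert (F2 : - (sg * dot v (Cminus (P r) (P u))) = sg * dot (Cminus (P u) (P r)) v)
  by (unfold dot; simpl; ring).
split.
- split; [exact A1|]. intros E. apply Hstrict; [|exact E|now apply A2].
  apply nsq_pos_idx; auto.
- rewrite F1, F2. split; [exact B1|]. intros E. apply Hstrict; [|exact E|now apply B2].
  apply nsq_pos_idx; auto.
Qed.

Lemma cone_open (sg : R) (t : tri) (u q r : nat) (v : CC) : In t T -> corner t u q r ->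
  incone sg (Cminus (P q) (P u)) (Cminus (P r) (P u)) v ->
  exists e, 0 < e /\ forall d, 0 < d < e -> t_open P t (arc sg (P u) v d).
Proof.
intros Ht Hc ((A1 & A2) & B1 & B2).
destruct (tri_facts t u q r Ht Hc) as (_ & _ & _ & Hor).
destruct (pos_or_next_near _ _ A1 A2) as (e1 & He1 & H1).
destruct (pos_or_next_near _ _ B1 B2) as (e2 & He2 & H2).
destruct (pos_near (orient (P q) (P r) (P u)) (cross (Cminus (P r) (P q)) v)
   (sg * dot (Cminus (P r) (P q)) v)) as (e3 & He3 & H3).
{ replace (orient (P q) (P r) (P u)) with (orient (P u) (P q) (P r)); [exact Hor|].
  unfold orient; ring. }
exists (Rmin e1 (Rmin e2 e3)). split; [now repeat apply Rmin_glb_lt|].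
intros d [Hd0 Hd].
assert (M1 := Rmin_l e1 (Rmin e2 e3)). assert (M2 := Rmin_r e1 (Rmin e2 e3)).
assert (M3 := Rmin_l e2 e3). assert (M4 := Rmin_r e2 e3).
specialize (H1 d ltac:(lra)). specialize (H2 d ltac:(lra)). specialize (H3 d ltac:(lra)).
apply (proj2 (corner_open P t u q r _ Hc)). rewrite !orient_arc. repeat split.
- destruct (orient_degenerate (P u) (P q)) as (_ & _ & E). rewrite E.
  assert (0 < d * (cross (Cminus (P q) (P u)) v + sg * dot (Cminus (P q) (P u)) v * d))
    by (apply Rmult_lt_0_compat; lra). lra.
- exact H3.
- destruct (orient_degenerate (P r) (P u)) as (_ & E & _). rewrite E.
  assert (0 < d * (cross v (Cminus (P r) (P u)) + - (sg * dot v (Cminus (P r) (P u))) * d))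
    by (apply Rmult_lt_0_compat; lra).
  unfold cross, dot in *; simpl in *. lra.
Qed.

(** Both triangles would contain the arc in their interiors for all small d, against
    disjointness. *)
Lemma cone_unique (sg : R) (i j : nat) (t s : tri) (u q r q' r' : nat) (v : CC) :
  nth_error T i = Some t -> nth_error T j = Some s ->
  corner t u q r -> corner s u q' r' ->
  incone sg (Cminus (P q) (P u)) (Cminus (P r) (P u)) v ->
  incone sg (Cminus (P q') (P u)) (Cminus (P r') (P u)) v -> i = j.
Proof.
intros Hi Hj Ct Cs It Is. destruct (Nat.eq_dec i j) as [|n]; [assumption|exfalso].
destruct HT as [(_ & Hdis & _) _].
destruct (cone_open sg t u q r v) as (e1 & He1 & H1); auto.
{ now apply nth_error_In with i. }
destruct (cone_open sg s u q' r' v) as (e2 & He2 & H2); auto.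
{ now apply nth_error_In with j. }
assert (M1 := Rmin_l e1 e2). assert (M2 := Rmin_r e1 e2).
assert (0 < Rmin e1 e2) by now apply Rmin_glb_lt.
apply (Hdis i j t s Hi Hj n (arc sg (P u) v (Rmin e1 e2 / 2))).
split; [apply H1|apply H2]; lra.
Qed.

Lemma cidx_idx (u : nat) : cidx N u -> idx N u.
Proof. unfold cidx, idx. lia. Qed.

Lemma vertex_closed (t : tri) (k : nat) : In t T -> t_has_vertex t k -> t_closed P t (P k).
Proof.
intros Ht Hk. destruct (vertex_corner t k Hk) as (q & r & Hc).
destruct (tri_facts t k q r Ht Hc) as (_ & _ & _ & Ho).
apply (proj2 (corner_closed P t k q r _ Hc)).
destruct (orient_degenerate (P k) (P q)) as (_ & _ & ->).
destruct (orient_degenerate (P r) (P k)) as (_ & -> & _).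
replace (orient (P q) (P r) (P k)) with (orient (P k) (P q) (P r)) by (unfold orient; ring).
lra.
Qed.

Lemma delaunay_incircle (t : tri) (u q r k : nat) : In t T -> corner t u q r -> idx N k ->
  0 <= incircle (P u) (P q) (P r) (P k).
Proof.
intros Ht Hc Hk. destruct HT as [_ HD].
assert (H : let '(a, b, c) := t in 0 <= incircle (P a) (P b) (P c) (P k)).
{ specialize (HD t Ht). destruct t as [[a b] c].
  destruct (tri_facts (a, b, c) a b c Ht (or_introl eq_refl)) as (_ & _ & _ & Ho).
  destruct (incircle_circumcenter _ _ _ Ho) as (o & E1 & E2 & H).
  apply H. now apply HD. }
destruct Hc as [-> | [-> | ->]]; [exact H| |].
- rewrite <- incircle_rotate. exact H.
- rewrite incircle_rotate. exact H.
Qed.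

Lemma two_vertices_corner (t : tri) (u w : nat) : t_has_vertex t u -> t_has_vertex t w ->
  u <> w -> exists r, corner t u w r \/ corner t u r w.
Proof.
intros Hu Hw n. destruct (vertex_corner t u Hu) as (q & r & Hc).
apply (corner_vertex t u q r w Hc) in Hw. destruct Hw as [-> | [-> | ->]]; [tauto| |].
- exists r. now left.
- exists q. now right.
Qed.

(** By convexity t would contain P k, hence have k as a vertex; but the third vertex of t is off the
    line uw. *)
Lemma segment_blocked (t : tri) (u w k : nat) : In t T ->
  t_has_vertex t u -> t_has_vertex t w -> u <> w -> idx N k -> k <> u -> k <> w ->
  orient (P u) (P w) (P k) = 0 -> chord_dot (P u) (P w) (P k) < 0 -> False.
Proof.
intros Ht Hu Hw n Hk nu nw HS HX.
destruct (two_vertices_corner t u w Hu Hw n) as (r & Hc).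
assert (Hwu : idx N u /\ idx N w /\ t_has_vertex t r /\ orient (P u) (P w) (P r) <> 0 /\
  (forall j, t_has_vertex t j -> j = u \/ j = w \/ j = r)).
{ destruct Hc as [Hc|Hc]; destruct (tri_facts _ _ _ _ Ht Hc) as (I1 & I2 & I3 & Ho);
  (split; [assumption|]); (split; [assumption|]);
  (split; [apply (corner_vertex _ _ _ _ _ Hc); tauto|]).
  - split; [lra|]. intros j Hj. now apply (corner_vertex _ _ _ _ _ Hc) in Hj.
  - split; [unfold orient in *; lra|].
    intros j Hj. apply (corner_vertex _ _ _ _ _ Hc) in Hj. tauto. }
destruct Hwu as (Iu & Iw & Hr & Hor & Hj).
assert (Hn : 0 < nsq (Cminus (P w) (P u))) by (apply nsq_pos_idx; auto).
destruct (collinear_param (P u) (P w) (P k) Hn) as (E & EX).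
{ unfold orient in HS. unfold cross; simpl. lra. }
set (l := dot (Cminus (P k) (P u)) (Cminus (P w) (P u)) / nsq (Cminus (P w) (P u))) in *.
assert (Hl : 0 <= l <= 1).
{ assert (l ^ 2 - l < 0); [|nra]. rewrite EX in HX.
  apply Rnot_le_lt. intros H. apply (Rlt_irrefl 0).
  apply Rle_lt_trans with (2 := HX). apply Rmult_le_pos; lra. }
assert (Hcl : t_closed P t (P k)).
{ rewrite E. apply closed_convex; [exact Hl| |]; now apply vertex_closed. }
destruct HT as [(_ & _ & _ & _ & Hemp) _].
destruct (Hj k (Hemp t k Ht Hk Hcl)) as [ | [ | ]]; [tauto|tauto|]. subst k. lra.
Qed.

(** Of two points on one ray from u, the nearer lies on the segment to the farther. If it is w, then
    w must be a vertex of t, but the third vertex is off the line; if it is k, then k lies strictly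
    between u and w, against the last hypothesis. *)
Lemma collinear_vertex (t : tri) (u w k : nat) : In t T ->
  t_has_vertex t u -> t_has_vertex t k -> u <> k -> idx N w -> w <> u ->
  cross (Cminus (P k) (P u)) (Cminus (P w) (P u)) = 0 ->
  0 < dot (Cminus (P k) (P u)) (Cminus (P w) (P u)) ->
  (forall j, idx N j -> j <> u -> j <> w -> orient (P u) (P w) (P j) = 0 ->
     0 <= chord_dot (P u) (P w) (P j)) -> w = k.
Proof.
intros Ht Hu Hk n Hw nw Hcr Hdot Hfree.
destruct (Nat.eq_dec w k) as [|nk]; [assumption|exfalso].
destruct (two_vertices_corner t u k Hu Hk n) as (r & Hc).
assert (F : idx N u /\ idx N k /\ orient (P u) (P k) (P r) <> 0 /\
  (forall j, t_has_vertex t j -> j = u \/ j = k \/ j = r)).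
{ destruct Hc as [Hc|Hc]; destruct (tri_facts _ _ _ _ Ht Hc) as (I1 & I2 & I3 & Ho);
  (split; [assumption|]); (split; [assumption|]).
  - split; [lra|]. intros j Hj. now apply (corner_vertex _ _ _ _ _ Hc) in Hj.
  - split; [unfold orient in *; lra|].
    intros j Hj. apply (corner_vertex _ _ _ _ _ Hc) in Hj. tauto. }
destruct F as (Iu & Ik & Hor & Hj).
assert (Hcr' : cross (Cminus (P w) (P u)) (Cminus (P k) (P u)) = 0)
  by (unfold cross in *; simpl in *; lra).
assert (Hn : 0 < nsq (Cminus (P k) (P u))) by (apply nsq_pos_idx; auto).
assert (Hnw : 0 < nsq (Cminus (P w) (P u))) by (apply nsq_pos_idx; auto).
destruct (collinear_param (P u) (P k) (P w) Hn Hcr') as (E & _).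
destruct (collinear_param (P u) (P w) (P k) Hnw Hcr) as (_ & EX).
set (d := dot (Cminus (P k) (P u)) (Cminus (P w) (P u))) in *.
replace (dot (Cminus (P w) (P u)) (Cminus (P k) (P u))) with d in E by (unfold d, dot; ring).
assert (Hdd : d ^ 2 = nsq (Cminus (P k) (P u)) * nsq (Cminus (P w) (P u))).
{ transitivity (d ^ 2 + cross (Cminus (P k) (P u)) (Cminus (P w) (P u)) ^ 2);
  [rewrite Hcr; ring|]. unfold d, dot, cross, nsq. ring. }
destruct (Rle_dec d (nsq (Cminus (P k) (P u)))) as [Hd|Hd].
- assert (Hcl : t_closed P t (P w)).
  { rewrite E. apply closed_convex; [|now apply vertex_closed|now apply vertex_closed].
    split.
    - apply Rlt_le, Rdiv_lt_0_compat; assumption.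
    - apply Rmult_le_reg_r with (nsq (Cminus (P k) (P u))); [assumption|].
      unfold Rdiv. rewrite Rmult_assoc, Rinv_l by lra. lra. }
  destruct HT as [(_ & _ & _ & _ & Hemp) _].
  destruct (Hj w (Hemp t w Ht Hw Hcl)) as [ | [ | ]]; [tauto|tauto|]. subst w.
  apply Hor. unfold orient. unfold cross in Hcr; simpl in Hcr. lra.
- assert (HS : orient (P u) (P w) (P k) = 0).
  { unfold orient. unfold cross in Hcr'; simpl in Hcr'. lra. }
  assert (HX := Hfree k Ik ltac:(auto) ltac:(auto) HS).
  rewrite EX in HX. assert (Hl : d < nsq (Cminus (P w) (P u))) by nra.
  set (m := nsq (Cminus (P w) (P u))) in *.
  assert (Hl1 : 0 < d / m < 1).
  { split; [now apply Rdiv_lt_0_compat|].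
    apply Rmult_lt_reg_r with m; [assumption|].
    unfold Rdiv. rewrite Rmult_assoc, Rinv_l by lra. lra. }
  assert (0 < d / m * (1 - d / m) * m) 
    by (apply Rmult_lt_0_compat; [apply Rmult_lt_0_compat|]; lra).
  lra.
Qed.

(** The incircle inequality compares the cotangents of the angles at r and at any other point on the
    left of uw, so r realizes the minimum. *)
Lemma left_cos_opposite (t : tri) (u w r : nat) : In t T -> corner t u w r ->
  opposite_cos N P u w = left_cos (P u) (P w) (P r).
Proof.
intros Ht Hc. destruct (tri_facts t u w r Ht Hc) as (Iu & Iw & Ir & Ho).
destruct (corner_distinct t u w r Ht Hc) as (D1 & D2 & D3).
assert (Hpos : forall k, idx N k -> k <> u -> k <> w ->
  0 < chord_dot (P u) (P w) (P k) ^ 2 + orient (P u) (P w) (P k) ^ 2).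
{ intros k Hk nu nw. rewrite chord_norm. apply Rmult_lt_0_compat; apply nsq_pos_idx; auto. }
assert (H1 : forall k, idx N k -> k <> u -> k <> w -> left_cos (P u) (P w) (P k) <= 1).
{ intros k Hk nu nw. unfold left_cos. destruct (Rle_dec _ _); [|lra].
  apply cosine_le_1. now apply Hpos. }
unfold opposite_cos.
apply (rmin_eq (fun k => left_cos (P u) (P w) (P k)) _ r).
- apply in_others. auto.
- apply H1; auto.
- intros k Hk. apply in_others in Hk. destruct Hk as (Hk & nu & nw).
  unfold left_cos at 2. destruct (Rle_dec 0 (orient (P u) (P w) (P k))) as [Hs|Hs].
  + rewrite left_cos_pos by lra. apply cosine_mono; auto.
    assert (H := delaunay_incircle t u w r k Ht Hc Hk). unfold incircle in H. lra.
  + apply H1; auto.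
Qed.

(** An edge uw of t is a side of its cone at u, and the arc bending towards the side on which t lies
    enters t. *)
Lemma corner_incone (t : tri) (u w r : nat) : In t T ->
  (corner t u w r -> incone 1 (Cminus (P w) (P u)) (Cminus (P r) (P u)) (Cminus (P w) (P u))) /\
  (corner t u r w -> incone (-1) (Cminus (P r) (P u)) (Cminus (P w) (P u)) (Cminus (P w) (P u))).
Proof.
intros Ht.
assert (E : cross (Cminus (P w) (P u)) (Cminus (P w) (P u)) = 0) by (unfold cross; ring).
assert (D : dot (Cminus (P w) (P u)) (Cminus (P w) (P u)) = nsq (Cminus (P w) (P u)))
  by (unfold dot, nsq; ring).
split; intros Hc; destruct (tri_facts _ _ _ _ Ht Hc) as (I1 & I2 & I3 & Ho);
  destruct (corner_distinct _ _ _ _ Ht Hc) as (D1 & D2 & D3).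
- change (orient (P u) (P w) (P r)) with
    (cross (Cminus (P w) (P u)) (Cminus (P r) (P u))) in Ho.
  split; [|split; [lra|intros; lra]].
  rewrite E, D. split; [lra|]. intros _. rewrite Rmult_1_l. apply nsq_pos_idx; auto.
- change (orient (P u) (P r) (P w)) with
    (cross (Cminus (P r) (P u)) (Cminus (P w) (P u))) in Ho.
  split; [split; [lra|intros; lra]|].
  rewrite E, D. split; [lra|]. intros _.
  assert (0 < nsq (Cminus (P w) (P u))) by (apply nsq_pos_idx; auto). lra.
Qed.

(* A vector in the angular sector from b to c can be parallel to one side only. *)
Lemma incone_sides (sg : R) (b c v : CC) : 0 < cross b c -> 0 < nsq v -> incone sg b c v ->
  (cross b v = 0 -> 0 < dot b v /\ 0 < cross v c) /\
  (cross v c = 0 -> 0 < dot v c /\ 0 < cross b v).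
Proof.
intros Hbc Hv ((A1 & A2) & B1 & B2).
assert (I1 : nsq v * cross b c = dot b v * cross v c + cross b v * dot v c)
  by (unfold nsq, cross, dot; ring).
assert (H : 0 < nsq v * cross b c) by now apply Rmult_lt_0_compat.
assert (F : forall x y, 0 <= y -> 0 < x * y -> 0 < x /\ 0 < y).
{ intros x y [Hy|<-] Hxy; [|lra]. split; [|assumption].
  apply Rmult_lt_reg_r with y; lra. }
split; intros E; rewrite E in I1; apply F; try assumption; lra.
Qed.

Lemma edge_sum (u w : nat) : cidx N u -> idx N w -> w <> u ->
  lsum (tri_form P u w) T = edge_form N P u w.
Proof.
intros Hu Hw n.
assert (Iu := cidx_idx u Hu).
assert (Hv : 0 < nsq (Cminus (P w) (P u))) by (apply nsq_pos_idx; auto).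
(* A point strictly between u and w sees the segment at the angle PI, so both minima are at most -1,
   and it prevents uw from being an edge. *)
destruct (classic (exists k, idx N k /\ k <> u /\ k <> w /\
   orient (P u) (P w) (P k) = 0 /\ chord_dot (P u) (P w) (P k) < 0)) as [HA|HA].
{ destruct HA as (k & Hk & nu & nw & HS & HX).
  rewrite lsum_0.
  2:{ intros t Ht. apply tri_form_absent. intros [Vu Vw].
      apply (segment_blocked t u w k); auto. }
  assert (Hc : left_cos (P u) (P w) (P k) = -1 /\ left_cos (P w) (P u) (P k) = -1).
  { assert (G : cosine (chord_dot (P u) (P w) (P k)) 0 = -1).
    { unfold cosine. replace (chord_dot (P u) (P w) (P k) ^ 2 + 0 ^ 2)
        with ((- chord_dot (P u) (P w) (P k)) ^ 2) by ring.
      rewrite sqrt_pow2 by lra. field. lra. }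
    split; rewrite left_cos_pos by (rewrite ?(orient_swap (P u) (P w)); lra).
    - now rewrite HS.
    - now rewrite orient_swap, chord_dot_swap, HS, Ropp_0. }
  unfold edge_form. rewrite edge_coef_0; [now rewrite Cmult_0_r|].
  assert (L1 := rmin_le (fun k => left_cos (P u) (P w) (P k)) (others N u w) k).
  assert (L2 := rmin_le (fun k => left_cos (P w) (P u) (P k)) (others N w u) k).
  rewrite in_others in L1, L2. fold (opposite_cos N P u w) in L1.
  fold (opposite_cos N P w u) in L2. simpl in L1, L2.
  specialize (L1 ltac:(auto)). specialize (L2 ltac:(auto)). lra. }
assert (Hfree : forall j, idx N j -> j <> u -> j <> w -> orient (P u) (P w) (P j) = 0 ->
     0 <= chord_dot (P u) (P w) (P j)).
{ intros j Hj j1 j2 j3. apply Rnot_lt_le. intros H. apply HA. exists j. auto. }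
set (v := Cminus (P w) (P u)) in *.
(* The triangles entered by the left and the right arc are the only ones that can have uw as an
   edge. *)
destruct (exists_cone 1 u v) as (t1 & q1 & r1 & Ht1 & Hc1 & Hi1); [lra|assumption|assumption|].
destruct (exists_cone (-1) u v) as (t2 & q2 & r2 & Ht2 & Hc2 & Hi2);
  [lra|assumption|assumption|].
destruct (In_nth_error _ _ Ht1) as (i1 & Hn1). destruct (In_nth_error _ _ Ht2) as (i2 & Hn2).
destruct (tri_facts _ _ _ _ Ht1 Hc1) as (_ & Iq1 & Ir1 & Ho1).
destruct (tri_facts _ _ _ _ Ht2 Hc2) as (_ & Iq2 & Ir2 & Ho2).
destruct (corner_distinct _ _ _ _ Ht1 Hc1) as (D1 & D2 & D3).
destruct (corner_distinct _ _ _ _ Ht2 Hc2) as (D4 & D5 & D6).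
destruct (incone_sides 1 (Cminus (P q1) (P u)) (Cminus (P r1) (P u)) v Ho1 Hv Hi1) as (S1 & S2).
destruct (incone_sides (-1) (Cminus (P q2) (P u)) (Cminus (P r2) (P u)) v Ho2 Hv Hi2) as (S3 & S4).
assert (Huniq : forall k s, nth_error T k = Some s ->
   t_has_vertex s u -> t_has_vertex s w -> k = i1 \/ k = i2).
{ intros k s Hk Vu Vw. destruct (two_vertices_corner s u w Vu Vw) as [r [Hc | Hc]]; [auto| |].
  - left. apply (cone_unique 1 k i1 s t1 u w r q1 r1 v); auto.
    apply (corner_incone s u w r); auto. now apply nth_error_In with k.
  - right. apply (cone_unique (-1) k i2 s t2 u r w q2 r2 v); auto.
    apply (corner_incone s u w r); auto. now apply nth_error_In with k. }
assert (Hzero : forall k s, nth_error T k = Some s -> k <> i1 -> k <> i2 ->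
   tri_form P u w s = RtoC 0).
{ intros k s Hk n1 n2. apply tri_form_absent. intros [Vu Vw].
  destruct (Huniq k s Hk Vu Vw); tauto. }
destruct (Req_dec (cross (Cminus (P q1) (P u)) v) 0) as [E1|E1].
- destruct (S1 E1) as (Hd1 & Hs1).
  assert (w = q1).
  { apply (collinear_vertex t1 u w q1); auto; apply (corner_vertex _ _ _ _ _ Hc1); tauto. }
  subst q1.
  destruct (Req_dec (cross v (Cminus (P r2) (P u))) 0) as [E2|E2].
  + destruct (S4 E2) as (Hd2 & Hs2).
    assert (w = r2).
    { apply (collinear_vertex t2 u w r2); auto; try (apply (corner_vertex _ _ _ _ _ Hc2); tauto).
      - unfold v, cross in *; simpl in *; lra.
      - unfold v, dot in *; simpl in *; lra. }
    subst r2.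
    assert (i1 <> i2).
    { intros <-. rewrite Hn1 in Hn2. injection Hn2 as <-.
      destruct (corner_unique t1 u w r1 q2 w Ht1 Hc1 Hc2). congruence. }
    rewrite (lsum_nth_two _ T i1 i2 t1 t2); auto.
    assert (Hc2' : corner t2 w u q2) by (unfold corner in *; tauto).
    rewrite (tri_form_left P t1 u w r1), (tri_form_right P t2 u w q2); auto.
    2:{ replace (orient (P w) (P u) (P q2)) with (orient (P u) (P q2) (P w));
        [exact Ho2|unfold orient; ring]. }
    rewrite <- Cmult_plus_distr_l. unfold edge_form. f_equal.
    rewrite (left_cos_opposite t1 u w r1), (left_cos_opposite t2 w u q2) by assumption.
    (* Since q2 is not inside the circumcircle of t1, the two opposite angles add up to at most PI
       and the truncation is inactive. *)
    unfold edge_coef. rewrite Rmax_left.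
    { unfold Cplus; simpl. f_equal; ring. }
    assert (Ho2' : 0 < - orient (P u) (P w) (P q2)) by (unfold orient in *; lra).
    rewrite left_cos_pos by lra. rewrite left_cos_pos by (rewrite (orient_swap (P u) (P w)); lra).
    rewrite (orient_swap (P u) (P w)), (chord_dot_swap (P u) (P w)), <- cosine_opp.
    apply cosine_mono; [lra|lra| |].
    * assert (H0 := pow2_ge_0 (chord_dot (P u) (P w) (P q2))).
      assert (0 < (- orient (P u) (P w) (P q2)) ^ 2) by (apply pow2_gt_0; lra). lra.
    * assert (H0 := delaunay_incircle t1 u w r1 q2 Ht1 Hc1 Iq2). unfold incircle in H0. lra.
  (* Here the direction of w would be strictly inside the angle of t2 at u, so the left arc would
     enter t2 as well; but then t2 = t1, which has uw as a side. *)
  + exfalso.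
    assert (E3 : cross (Cminus (P q2) (P u)) v <> 0 ).
    { intros E. destruct (S3 E) as (Hd & _). destruct Hi2 as ((_ & A) & _).
      specialize (A E). lra. }
    assert (Hi2' : incone 1 (Cminus (P q2) (P u)) (Cminus (P r2) (P u)) v).
    { destruct Hi2 as ((A1 & A2) & B1 & B2). split; split; auto; intros; lra. }
    assert (i1 = i2) by (apply (cone_unique 1 i1 i2 t1 t2 u w r1 q2 r2 v); auto).
    subst i2. rewrite Hn1 in Hn2. injection Hn2 as <-.
    destruct (corner_unique t1 u w r1 q2 r2 Ht1 Hc1 Hc2) as [<- _]. tauto.
(* The direction of w is now strictly inside the angle of t1 at u; both arcs enter t1 and no
   triangle has the edge uw. *)
- assert (E2 : cross v (Cminus (P r1) (P u)) <> 0).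
  { intros E. destruct (S2 E) as (Hd & _). destruct Hi1 as (_ & _ & B). specialize (B E). lra. }
  destruct Hi1 as ((A1 & A2) & B1 & B2).
  assert (i1 = i2).
  { apply (cone_unique (-1) i1 i2 t1 t2 u q1 r1 q2 r2 v); auto.
    split; split; auto; intros; lra. }
  subst i2.
  assert (V1 : ~ t_has_vertex t1 w).
  { intros V. apply (corner_vertex _ _ _ _ _ Hc1) in V. destruct V as [ | [ | ]]; [tauto| |];
    subst w; [apply E1|apply E2]; unfold v, cross; ring. }
  rewrite lsum_nth_0.
  2:{ intros k s Hk. destruct (Nat.eq_dec k i1) as [->|nk]; [|now apply (Hzero k)].
      apply tri_form_absent. rewrite Hn1 in Hk. injection Hk as <-. tauto. }
  unfold edge_form. rewrite edge_coef_0; [now rewrite Cmult_0_r|].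
  assert (w <> q1 /\ w <> r1) as [n1 n2].
  { split; intros ->; apply V1; apply (corner_vertex _ _ _ _ _ Hc1); tauto. }
  assert (L1 := rmin_le (fun k => left_cos (P u) (P w) (P k)) (others N u w) r1).
  assert (L2 := rmin_le (fun k => left_cos (P w) (P u) (P k)) (others N w u) q1).
  rewrite in_others in L1, L2. fold (opposite_cos N P u w) in L1.
  fold (opposite_cos N P w u) in L2. simpl in L1, L2.
  specialize (L1 ltac:(auto)). specialize (L2 ltac:(auto)).
  assert (O1 : 0 < orient (P u) (P w) (P r1)).
  { change (orient (P u) (P w) (P r1)) with (cross v (Cminus (P r1) (P u))). lra. }
  assert (O2 : 0 < orient (P w) (P u) (P q1)).
  { replace (orient (P w) (P u) (P q1)) with (cross (Cminus (P q1) (P u)) v); [lra|].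
    unfold v, cross, orient; simpl; ring. }
  (* Since w is not inside the circumcircle of t1, the angles at q1 and r1 under which uw is seen
     add up to at least PI. *)
  assert (G : left_cos (P u) (P w) (P r1) <= - left_cos (P w) (P u) (P q1)); [|lra].
  rewrite !left_cos_pos by lra. rewrite <- cosine_opp. apply cosine_mono; [lra|lra| |].
  + assert (H0 := pow2_ge_0 (- chord_dot (P w) (P u) (P q1))).
    assert (0 < orient (P w) (P u) (P q1) ^ 2) by (apply pow2_gt_0; lra). lra.
  + assert (H0 := delaunay_incircle t1 u q1 r1 w Ht1 Hc1 Hw).
    rewrite (chord_dot_swap (P u) (P w)), (orient_swap (P u) (P w)).
    assert (J : incircle (P u) (P q1) (P r1) (P w) =
      chord_dot (P u) (P w) (P r1) * orient (P u) (P w) (P q1)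
      - chord_dot (P u) (P w) (P q1) * orient (P u) (P w) (P r1)).
    { unfold incircle, chord_dot, orient, dot; simpl. ring. }
    lra.
Qed.
End Delaunay.

(** * Continuity of the edge form in the configuration *)

Definition near (N : nat) (z : nat -> CC) (Q : (nat -> CC) -> Prop) : Prop :=
  exists d, 0 < d /\ forall z', (forall k, cidx N k -> Cmod (Cminus (z' k) (z k)) < d) -> Q z'.

Lemma Cmod_minus_diag (a : CC) : Cmod (Cminus a a) = 0.
Proof.
replace (Cminus a a) with (RtoC 0) by (unfold Cminus; now rewrite Cplus_opp_r).
apply Cmod_0.
Qed.

Lemma near_self (N : nat) (z : nat -> CC) (Q : (nat -> CC) -> Prop) : near N z Q -> Q z.
Proof. intros (d & Hd & H). apply H. intros k _. now rewrite Cmod_minus_diag. Qed.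

#[local] Instance near_filter (N : nat) (z : nat -> CC) : Filter (near N z).
Proof.
split.
- exists 1. split; [lra|auto].
- intros Q Q' (d & Hd & H) (d' & Hd' & H'). exists (Rmin d d').
  split; [now apply Rmin_glb_lt|]. intros y Hy.
  assert (M1 := Rmin_l d d'). assert (M2 := Rmin_r d d').
  split; [apply H|apply H']; intros k Hk; specialize (Hy k Hk); lra.
- intros Q Q' HQ (d & Hd & H). exists d. split; [exact Hd|]. intros y Hy. now apply HQ, H.
Qed.

Section Continuity.
Variables (N : nat) (z1 z2 z3 : CC) (z : nat -> CC).
Local Notation pt := (pts z1 z2 z3).

Definition cont (F : (nat -> CC) -> R) : Prop := filterlim F (near N z) (locally (F z)).

Lemma cont_ext_near (F G : (nat -> CC) -> R) :
  near N z (fun y => F y = G y) -> cont F -> cont G.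
Proof.
intros H HF. unfold cont. rewrite <- (near_self N z _ H).
now apply filterlim_ext_loc with (1 := H).
Qed.

Lemma cont_const (c : R) : cont (fun _ => c).
Proof. apply filterlim_const. Qed.

Lemma cont_comp (g : R -> R) (F : (nat -> CC) -> R) :
  continuous g (F z) -> cont F -> cont (fun y => g (F y)).
Proof. intros Hg HF. exact (filterlim_comp _ _ _ F g _ _ _ HF Hg). Qed.

Lemma cont_plus (F G : (nat -> CC) -> R) : cont F -> cont G -> cont (fun y => F y + G y).
Proof.
intros HF HG. exact (filterlim_comp_2 F G Rplus HF HG
  (filterlim_plus (V := R_NormedModule) (F z) (G z))).
Qed.

Lemma cont_mult (F G : (nat -> CC) -> R) : cont F -> cont G -> cont (fun y => F y * G y).
Proof.
intros HF HG. exact (filterlim_comp_2 F G Rmult HF HG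
  (filterlim_mult (K := R_AbsRing) (F z) (G z))).
Qed.

Lemma cont_opp (F : (nat -> CC) -> R) : cont F -> cont (fun y => - F y).
Proof.
apply (cont_comp Ropp). apply (ex_derive_continuous Ropp). now auto_derive.
Qed.

Lemma cont_minus (F G : (nat -> CC) -> R) : cont F -> cont G -> cont (fun y => F y - G y).
Proof. intros HF HG. now apply cont_plus, cont_opp. Qed.

Lemma cont_inv (F : (nat -> CC) -> R) : F z <> 0 -> cont F -> cont (fun y => / F y).
Proof.
intros H. apply (cont_comp Rinv). apply (ex_derive_continuous Rinv). now auto_derive.
Qed.

Lemma cont_pow2 (F : (nat -> CC) -> R) : cont F -> cont (fun y => F y ^ 2).
Proof.
apply (cont_comp (fun x => x ^ 2)). apply (ex_derive_continuous (fun x => x ^ 2)).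
now auto_derive.
Qed.

Lemma cont_sqrt (F : (nat -> CC) -> R) : cont F -> cont (fun y => sqrt (F y)).
Proof. apply (cont_comp sqrt). apply continuous_sqrt. Qed.

Lemma cont_Rmax (F G : (nat -> CC) -> R) : cont F -> cont G -> cont (fun y => Rmax (F y) (G y)).
Proof.
intros HF HG.
apply cont_ext_near with (fun y => / 2 * (F y + G y + Rabs (F y - G y))).
- apply filter_forall. intros y.
  destruct (Rle_dec (F y) (G y)).
  + rewrite Rmax_right, Rabs_left1 by lra. field.
  + rewrite Rmax_left, Rabs_pos_eq by lra. field.
- apply cont_mult; [apply cont_const|]. apply cont_plus; [now apply cont_plus|].
  apply (cont_comp Rabs); [apply continuous_Rabs|now apply cont_minus].
Qed.

Lemma cont_Rmin (F G : (nat -> CC) -> R) : cont F -> cont G -> cont (fun y => Rmin (F y) (G y)).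
Proof.
intros HF HG. apply cont_ext_near with (fun y => - Rmax (- F y) (- G y)).
- apply filter_forall. intros y. rewrite Ropp_Rmax, !Ropp_involutive. reflexivity.
- now apply cont_opp, cont_Rmax; apply cont_opp.
Qed.

Lemma cont_lt (F : (nat -> CC) -> R) (c : R) : cont F -> F z < c -> near N z (fun y => F y < c).
Proof. intros HF H. apply (HF (fun x => x < c)). now apply open_lt. Qed.

Lemma cont_gt (F : (nat -> CC) -> R) (c : R) : cont F -> c < F z -> near N z (fun y => c < F y).
Proof. intros HF H. apply (HF (fun x => c < x)). now apply open_gt. Qed.

Lemma cont_pt (k : nat) : idx N k ->
  cont (fun y => fst (pt y k)) /\ cont (fun y => snd (pt y k)).
Proof.
intros Hk.
assert (G : cidx N k -> cont (fun y => fst (y k)) /\ cont (fun y => snd (y k))).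
{ intros Hc. split; apply filterlim_locally; intros eps; exists eps;
  (split; [apply cond_pos|]); intros y Hy; specialize (Hy k Hc);
  apply Rle_lt_trans with (2 := Hy); apply Rle_trans with (2 := Rmax_Cmod _).
  - apply Rmax_l.
  - apply Rmax_r. }
destruct k as [|[|[|[|k]]]]; unfold idx in Hk; try lia;
  try (split; apply cont_const).
apply G. unfold cidx. lia.
Qed.

Lemma cont_orient (a b c : nat) : idx N a -> idx N b -> idx N c ->
  cont (fun y => orient (pt y a) (pt y b) (pt y c)).
Proof.
intros Ha Hb Hc.
destruct (cont_pt a Ha) as [a1 a2], (cont_pt b Hb) as [b1 b2], (cont_pt c Hc) as [c1 c2].
exact (cont_minus _ _ (cont_mult _ _ (cont_minus _ _ b1 a1) (cont_minus _ _ c2 a2))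
                      (cont_mult _ _ (cont_minus _ _ b2 a2) (cont_minus _ _ c1 a1))).
Qed.

Lemma cont_chord_dot (a b c : nat) : idx N a -> idx N b -> idx N c ->
  cont (fun y => chord_dot (pt y a) (pt y b) (pt y c)).
Proof.
intros Ha Hb Hc.
destruct (cont_pt a Ha) as [a1 a2], (cont_pt b Hb) as [b1 b2], (cont_pt c Hc) as [c1 c2].
exact (cont_plus _ _ (cont_mult _ _ (cont_minus _ _ a1 c1) (cont_minus _ _ b1 c1))
                     (cont_mult _ _ (cont_minus _ _ a2 c2) (cont_minus _ _ b2 c2))).
Qed.

Lemma cont_nsq (a b : nat) : idx N a -> idx N b ->
  cont (fun y => nsq (Cminus (pt y a) (pt y b))).
Proof.
intros Ha Hb.
destruct (cont_pt a Ha) as [a1 a2], (cont_pt b Hb) as [b1 b2].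
exact (cont_plus _ _ (cont_pow2 _ (cont_minus _ _ a1 b1)) (cont_pow2 _ (cont_minus _ _ a2 b2))).
Qed.

Lemma cont_cosine (X S : (nat -> CC) -> R) : cont X -> cont S -> 0 < X z ^ 2 + S z ^ 2 ->
  cont (fun y => cosine (X y) (S y)).
Proof.
intros HX HS H. unfold cosine, Rdiv. apply cont_mult; [exact HX|].
apply cont_inv; [apply Rgt_not_eq; now apply sqrt_lt_R0|].
apply cont_sqrt, cont_plus; now apply cont_pow2.
Qed.

(* The only discontinuities are at the points p of the open segment ab. *)
Lemma cont_left_cos (a b p : nat) : idx N a -> idx N b -> idx N p ->
  0 < nsq (Cminus (pt z a) (pt z p)) -> 0 < nsq (Cminus (pt z b) (pt z p)) ->
  (orient (pt z a) (pt z b) (pt z p) = 0 -> 0 <= chord_dot (pt z a) (pt z b) (pt z p)) ->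
  cont (fun y => left_cos (pt y a) (pt y b) (pt y p)).
Proof.
intros Ha Hb Hp Hn1 Hn2 Hfree.
assert (CS := cont_orient a b p Ha Hb Hp). assert (CX := cont_chord_dot a b p Ha Hb Hp).
assert (Hpos := chord_norm (pt z a) (pt z b) (pt z p)).
assert (0 < nsq (Cminus (pt z a) (pt z p)) * nsq (Cminus (pt z b) (pt z p)))
  by now apply Rmult_lt_0_compat.
rewrite <- Hpos in H. clear Hpos.
destruct (Rtotal_order (orient (pt z a) (pt z b) (pt z p)) 0) as [HS|[HS|HS]].
- apply cont_ext_near with (fun _ => 1); [|apply cont_const].
  generalize (cont_lt _ 0 CS HS). apply filter_imp. intros y Hy.
  unfold left_cos. destruct (Rle_dec _ _); lra.
- assert (HX : 0 < chord_dot (pt z a) (pt z b) (pt z p)).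
  { destruct (Hfree HS) as [HX|HX]; [exact HX|]. rewrite HS, <- HX in H. lra. }
  (* On the line outside the segment the dot product is positive; truncating the orientation at 0
     then gives the cosine 1 on the right, the value chosen in [left_cos]. *)
  apply cont_ext_near with (fun y => cosine (chord_dot (pt y a) (pt y b) (pt y p))
    (Rmax (orient (pt y a) (pt y b) (pt y p)) 0)).
  + generalize (cont_gt _ 0 CX HX). apply filter_imp. intros y Hy.
    unfold left_cos. destruct (Rle_dec _ _).
    * now rewrite Rmax_left.
    * rewrite Rmax_right by lra. unfold cosine.
      replace (_ ^ 2 + 0 ^ 2) with (chord_dot (pt y a) (pt y b) (pt y p) ^ 2) by ring.
      rewrite sqrt_pow2 by lra. field. lra.
  + apply cont_cosine; [exact CX|apply cont_Rmax; [exact CS|apply cont_const]|].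
    rewrite HS, Rmax_left by lra. rewrite HS in H. exact H.
- apply cont_ext_near with (fun y => cosine (chord_dot (pt y a) (pt y b) (pt y p))
    (orient (pt y a) (pt y b) (pt y p))); [|now apply cont_cosine].
  generalize (cont_gt _ 0 CS HS). apply filter_imp. intros y Hy.
  symmetry. apply left_cos_pos. lra.
Qed.

Lemma cont_rmin (f : (nat -> CC) -> nat -> R) (l : list nat) :
  (forall k, In k l -> cont (fun y => f y k)) -> cont (fun y => rmin (f y) l).
Proof.
induction l as [|a l IH]; intros H; simpl.
- apply cont_const.
- apply cont_Rmin; [apply H; now left|]. apply IH. intros k Hk. apply H; now right.
Qed.

Definition contC (F : (nat -> CC) -> CC) : Prop :=
  cont (fun y => fst (F y)) /\ cont (fun y => snd (F y)).

Lemma contC_ext_near (F G : (nat -> CC) -> CC) :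
  near N z (fun y => F y = G y) -> contC F -> contC G.
Proof.
intros H [H1 H2]. split.
- revert H1. apply cont_ext_near. revert H. apply filter_imp. now intros y ->.
- revert H2. apply cont_ext_near. revert H. apply filter_imp. now intros y ->.
Qed.

Lemma contC_const (c : CC) : contC (fun _ => c).
Proof. split; apply cont_const. Qed.

Lemma contC_opp (F : (nat -> CC) -> CC) : contC F -> contC (fun y => Copp (F y)).
Proof. intros [H1 H2]. split; now apply cont_opp. Qed.

Lemma contC_lsum (F : (nat -> CC) -> nat -> CC) (l : list nat) :
  (forall k, In k l -> contC (fun y => F y k)) -> contC (fun y => lsum (F y) l).
Proof.
induction l as [|a l IH]; intros H; simpl.
- apply contC_const.
- destruct (H a (or_introl eq_refl)) as [A1 A2].
  destruct IH as [B1 B2]. { intros k Hk. apply H; now right. }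
  split; now apply cont_plus.
Qed.

Lemma contC_delta (F : (nat -> CC) -> CC) : contC F ->
  forall eps, 0 < eps -> near N z (fun y => Cmod (Cminus (F y) (F z)) < eps).
Proof.
intros [H1 H2] eps He.
assert (He2 : 0 < eps / 2) by lra.
assert (K1 := proj1 (filterlim_locally _ _) H1 (mkposreal _ He2)).
assert (K2 := proj1 (filterlim_locally _ _) H2 (mkposreal _ He2)).
generalize (filter_and _ _ K1 K2). apply filter_imp. intros y [B1 B2].
change (Rabs (fst (F y) - fst (F z)) < eps / 2) in B1.
change (Rabs (snd (F y) - snd (F z)) < eps / 2) in B2.
apply Rle_lt_trans with (1 := Cmod_2Rmax _).
assert (Hs : sqrt 2 < 2).
{ rewrite <- (sqrt_pow2 2) at 2 by lra. apply sqrt_lt_1; lra. }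
assert (Hs0 : 0 < sqrt 2) by (apply sqrt_lt_R0; lra).
set (m := Rmax _ _).
assert (Hm : m < eps / 2) by (apply Rmax_lub_lt; assumption).
assert (Hm0 : 0 <= m) by (apply Rle_trans with (2 := Rmax_l _ _); apply Rabs_pos).
nra.
Qed.

Hypothesis Hnc : orient z1 z2 z3 <> 0.
Hypothesis Hadm : admissible N z1 z2 z3 z.

(* u is a convex combination of z1, z2, z3 with positive coefficients, so the three corners
   do not all lie on one side of a line through u. *)
Lemma corner_on_left (u : nat) (q : CC) : cidx N u -> 0 < nsq (Cminus q (pt z u)) ->
  exists j, idx N j /\ j <> u /\ 0 < orient (pt z u) q (pt z j).
Proof.
intros Hu Hv.
assert (EP : pt z u = z u)
  by (destruct u as [|[|[|[|u]]]]; unfold cidx in Hu; try lia; reflexivity).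
destruct (proj1 Hadm u Hu) as (I1 & I2 & I3). rewrite <- EP in I1, I2, I3.
replace (orient z2 z3 z1) with (orient z1 z2 z3) in I2 by (unfold orient; ring).
replace (orient z3 z1 z2) with (orient z1 z2 z3) in I3 by (unfold orient; ring).
assert (J : exists j, (j = 1%nat \/ j = 2%nat \/ j = 3%nat) /\
   0 < orient (pt z u) q (pt z j)).
{ apply NNPP. intros H.
  assert (L : forall j, (j = 1%nat \/ j = 2%nat \/ j = 3%nat) ->
     orient (pt z u) q (pt z j) <= 0).
  { intros j Hj. apply Rnot_lt_le. intros Hlt. apply H. now exists j. }
  assert (L1 := L 1%nat ltac:(auto)). assert (L2 := L 2%nat ltac:(auto)).
  assert (L3 := L 3%nat ltac:(auto)). simpl pts in L1, L2, L3. clear L H.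
  set (p := pt z u) in *. clearbody p. clear EP.
  (* The areas are barycentric weights of p, and [orient p q] is affine in its last argument and
     vanishes at p. *)
  assert (S : orient z2 z3 p * orient z1 z2 z3 * - orient p q z1
            + orient z3 z1 p * orient z1 z2 z3 * - orient p q z2
            + orient z1 z2 p * orient z1 z2 z3 * - orient p q z3 = 0)
    by (unfold orient; ring).
  assert (P1 : 0 <= orient z2 z3 p * orient z1 z2 z3 * - orient p q z1)
    by (apply Rmult_le_pos; lra).
  assert (P2 : 0 <= orient z3 z1 p * orient z1 z2 z3 * - orient p q z2)
    by (apply Rmult_le_pos; lra).
  assert (P3 : 0 <= orient z1 z2 p * orient z1 z2 z3 * - orient p q z3)
    by (apply Rmult_le_pos; lra).
  assert (Z : forall x y, 0 < x -> x * - y = 0 -> y = 0).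
  { intros x y Hx Hxy. apply Rmult_integral in Hxy. lra. }
  assert (E1 : orient p q z1 = 0) by (apply (Z _ _ I2); lra).
  assert (E2 : orient p q z2 = 0) by (apply (Z _ _ I3); lra).
  assert (E3 : orient p q z3 = 0) by (apply (Z _ _ I1); lra).
  (* An affine function that vanishes at three non-collinear points has gradient 0, which here means
     q = p. *)
  assert (F1 : orient z1 z2 z3 * (fst q - fst p) = 0).
  { transitivity ((fst z2 - fst z1) * (orient p q z3 - orient p q z1)
      - (fst z3 - fst z1) * (orient p q z2 - orient p q z1)); [unfold orient; ring|].
    rewrite E1, E2, E3. ring. }
  assert (F2 : orient z1 z2 z3 * (snd q - snd p) = 0).
  { transitivity ((snd z2 - snd z1) * (orient p q z3 - orient p q z1)
      - (snd z3 - snd z1) * (orient p q z2 - orient p q z1)); [unfold orient; ring|].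
    rewrite E1, E2, E3. ring. }
  apply Rmult_integral in F1. apply Rmult_integral in F2.
  destruct F1 as [F1|F1]; [tauto|]. destruct F2 as [F2|F2]; [tauto|].
  unfold nsq, Cminus, Cplus, Copp in Hv; simpl fst in Hv; simpl snd in Hv.
  replace (fst q + - fst p) with 0 in Hv by lra.
  replace (snd q + - snd p) with 0 in Hv by lra. lra. }
destruct J as (j & Hj & Hlt). exists j.
split; [unfold idx; lia|]. split; [unfold cidx in Hu; lia|]. exact Hlt.
Qed.

Lemma left_cos_lt_1 (u w j : nat) : idx N u -> idx N w -> idx N j ->
  0 < orient (pt z u) (pt z w) (pt z j) ->
  left_cos (pt z u) (pt z w) (pt z j) < 1 /\
  cont (fun y => left_cos (pt y u) (pt y w) (pt y j)).
Proof.
intros Hu Hw Hj Ho.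
assert (Hp : 0 < chord_dot (pt z u) (pt z w) (pt z j) ^ 2 + orient (pt z u) (pt z w) (pt z j) ^ 2).
{ assert (H := pow2_ge_0 (chord_dot (pt z u) (pt z w) (pt z j))).
  assert (0 < orient (pt z u) (pt z w) (pt z j) ^ 2) by (apply pow2_gt_0; lra). lra. }
split.
- rewrite left_cos_pos by lra. assert (E := cosine_sqr _ _ Hp).
  assert (0 < orient (pt z u) (pt z w) (pt z j) ^ 2 / (chord_dot (pt z u) (pt z w) (pt z j) ^ 2
    + orient (pt z u) (pt z w) (pt z j) ^ 2))
    by (apply Rdiv_lt_0_compat; [apply pow2_gt_0|]; lra).
  set (c := cosine _ _) in *. assert (c ^ 2 < 1 ^ 2) by lra. nra.
- rewrite chord_norm in Hp.
  assert (H0 : forall a, 0 <= nsq a) by (intros a; unfold nsq; nra).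
  assert (A := H0 (Cminus (pt z u) (pt z j))). assert (B := H0 (Cminus (pt z w) (pt z j))).
  apply cont_left_cos; auto; try lra; nra.
Qed.

Lemma opposite_cos_le (y : nat -> CC) (u w k : nat) : idx N k -> k <> u -> k <> w ->
  opposite_cos N (pt y) u w <= left_cos (pt y u) (pt y w) (pt y k).
Proof.
intros Hk nu nw. apply (rmin_le (fun k => left_cos (pt y u) (pt y w) (pt y k))).
now apply in_others.
Qed.

(** If k lies strictly between u and w, then in nearby configurations it gives a cosine close to -1
    on one side, while an outer vertex on the other side keeps that minimum below 1 by a margin; the
    sum is negative and the form is 0. Otherwise every [left_cos] involved is continuous. *)
Lemma contC_edge_form (u w : nat) : cidx N u -> idx N w -> w <> u ->
  contC (fun y => edge_form N (pt y) u w).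
Proof.
intros Hu Hw n.
assert (Iu : idx N u) by (unfold cidx, idx in *; lia).
assert (Hdist : forall a b, idx N a -> idx N b -> a <> b -> 0 < nsq (Cminus (pt z a) (pt z b)))
  by (intros; now apply (nsq_pos_idx N z1 z2 z3 z)).
destruct (classic (exists k, idx N k /\ k <> u /\ k <> w /\
   orient (pt z u) (pt z w) (pt z k) = 0 /\ chord_dot (pt z u) (pt z w) (pt z k) < 0)) as [HA|HA].
- destruct HA as (k & Hk & nu & nw & HS & HX).
  apply contC_ext_near with (fun _ => RtoC 0); [|apply contC_const].
  assert (Hwu : 0 < nsq (Cminus (pt z w) (pt z u))) by (apply Hdist; auto).
  destruct (corner_on_left u (pt z w) Hu Hwu) as (j & Ij & ju & Hj).
  assert (jw : j <> w) by (intros ->; unfold orient in Hj; lra).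
  (* The reflection of w in u reverses the direction, so a point on its left lies on the right of
     uw. *)
  destruct (corner_on_left u (2 * fst (pt z u) - fst (pt z w), 2 * snd (pt z u) - snd (pt z w)) Hu)
    as (i & Ii & iu & Hi).
  { eapply Rlt_le_trans; [exact Hwu|]. right. unfold nsq; simpl. ring. }
  assert (Hi' : 0 < orient (pt z w) (pt z u) (pt z i)).
  { eapply Rlt_le_trans; [exact Hi|]. right. unfold orient; simpl. ring. }
  clear Hi. rename Hi' into Hi.
  assert (iw : i <> w) by (intros ->; unfold orient in Hi; lra).
  destruct (left_cos_lt_1 u w j Iu Hw Ij Hj) as [Lj Cj].
  destruct (left_cos_lt_1 w u i Hw Iu Ii Hi) as [Li Ci].
  (* Insensitive to the sign of the orientation, [G] is continuous across the segment and equals the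
     cosine for k on whichever side k lies. *)
  set (G := fun y => cosine (chord_dot (pt y u) (pt y w) (pt y k))
    (orient (pt y u) (pt y w) (pt y k))).
  assert (CG : cont G).
  { apply cont_cosine; [now apply cont_chord_dot|now apply cont_orient|].
    rewrite chord_norm. apply Rmult_lt_0_compat; apply Hdist; auto. }
  assert (EG : G z = -1).
  { unfold G. rewrite HS. unfold cosine. replace (chord_dot (pt z u) (pt z w) (pt z k) ^ 2 + 0 ^ 2)
      with ((- chord_dot (pt z u) (pt z w) (pt z k)) ^ 2) by ring.
    rewrite sqrt_pow2 by lra. field. lra. }
  assert (N1 := cont_lt _ 0 (cont_plus _ _ CG Cj) ltac:(lra)).
  assert (N2 := cont_lt _ 0 (cont_plus _ _ CG Ci) ltac:(lra)).
  generalize (filter_and _ _ N1 N2). apply filter_imp. intros y [Y1 Y2].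
  symmetry. unfold edge_form. rewrite edge_coef_0; [now rewrite Cmult_0_r|].
  destruct (Rle_dec 0 (orient (pt y u) (pt y w) (pt y k))) as [Ho|Ho].
  + assert (K1 := opposite_cos_le y u w k Hk nu nw).
    assert (K2 := opposite_cos_le y w u i Ii iw iu).
    rewrite left_cos_pos in K1 by lra. fold (G y) in K1. lra.
  + assert (K1 := opposite_cos_le y w u k Hk nw nu).
    assert (K2 := opposite_cos_le y u w j Ij ju jw).
    rewrite left_cos_pos in K1 by (rewrite orient_swap; lra).
    rewrite orient_swap, chord_dot_swap in K1.
    replace (cosine _ _) with (G y) in K1; [lra|].
    unfold G, cosine. f_equal. f_equal. ring.
- assert (Hfree : forall j, idx N j -> j <> u -> j <> w ->
    orient (pt z u) (pt z w) (pt z j) = 0 -> 0 <= chord_dot (pt z u) (pt z w) (pt z j)).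
  { intros j Hj j1 j2 j3. apply Rnot_lt_le. intros H. apply HA. exists j. auto. }
  assert (C1 : cont (fun y => opposite_cos N (pt y) u w)).
  { apply (cont_rmin (fun y k => left_cos (pt y u) (pt y w) (pt y k))).
    intros k Hk. apply in_others in Hk. destruct Hk as (Hk & k1 & k2).
    apply cont_left_cos; auto. }
  assert (C2 : cont (fun y => opposite_cos N (pt y) w u)).
  { apply (cont_rmin (fun y k => left_cos (pt y w) (pt y u) (pt y k))).
    intros k Hk. apply in_others in Hk. destruct Hk as (Hk & k1 & k2).
    apply cont_left_cos; auto.
    rewrite orient_swap, chord_dot_swap. intros E. apply Hfree; auto. lra. }
  assert (Cn : cont (fun y => - / (2 * nsq (Cminus (pt y u) (pt y w))))).
  { apply cont_opp, cont_inv.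
    - assert (H := Hdist u w Iu Hw (not_eq_sym n)). lra.
    - apply cont_mult; [apply cont_const|now apply cont_nsq]. }
  assert (C3 := cont_Rmax _ _ C2 (cont_opp _ C1)).
  assert (Chalf : forall F, cont F -> cont (fun y => F y * sqrt (1 - F y ^ 2))).
  { intros F HF. apply cont_mult; [exact HF|]. apply cont_sqrt, cont_minus.
    - apply cont_const.
    - now apply cont_pow2. }
  assert (R1 := cont_plus _ _ (Chalf _ C1) (Chalf _ C3)).
  assert (R2 := cont_minus _ _ (cont_pow2 _ C3) (cont_pow2 _ C1)).
  assert (R0 := cont_const 0).
  split.
  + exact (cont_minus _ _ (cont_mult _ _ Cn R1) (cont_mult _ _ R0 R2)).
  + exact (cont_plus _ _ (cont_mult _ _ Cn R2) (cont_mult _ _ R0 R1)).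
Qed.
End Continuity.

(** * The extended form *)

Lemma edge_form_diag (N : nat) (z1 z2 z3 : CC) (z : nat -> CC) (T : list tri) (u : nat) :
  admissible N z1 z2 z3 z -> is_delaunay N z1 z2 z3 z T -> cidx N u ->
  lsum (tri_form (pts z1 z2 z3 z) u u) T =
  Copp (lsum (fun w => if Nat.eqb w u then RtoC 0 else edge_form N (pts z1 z2 z3 z) u w)
             (seq 1 (N + 3))).
Proof.
intros Hadm HT Hu. set (P := pts z1 z2 z3 z).
assert (Hin : In u (seq 1 (N + 3))) by (apply in_seq; unfold cidx in Hu; lia).
assert (Hsplit : forall f l, NoDup l -> In u l ->
  lsum f l = Cplus (f u) (lsum (fun w => if Nat.eqb w u then RtoC 0 else f w) l)).
{ intros f l Hl. induction Hl as [|a l Ha Hl IH]; intros Hul; [destruct Hul|].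
  simpl. destruct (Nat.eqb_spec a u) as [->|n].
  - rewrite Cplus_0_l. f_equal. apply lsum_ext. intros w Hw.
    destruct (Nat.eqb_spec w u) as [->|]; [tauto|reflexivity].
  - destruct Hul as [|Hul]; [tauto|]. rewrite (IH Hul).
    rewrite !Cplus_assoc. f_equal. apply Cplus_comm. }
assert (Hkron : forall k l, NoDup l -> In k l -> rsum (kron k) l = 1).
{ intros k l Hl. induction Hl as [|a l Ha Hl IH]; intros Hkl; [destruct Hkl|].
  simpl. destruct (Nat.eq_dec k a) as [<-|n].
  - rewrite kron_same. replace (rsum (kron k) l) with 0; [ring|].
    clear - Ha. induction l as [|b l IH]; [reflexivity|]. simpl in *.
    rewrite <- IH by tauto. rewrite kron_other by (intros ->; tauto). ring.
  - destruct Hkl as [|Hkl]; [congruence|]. rewrite kron_other by assumption.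
    rewrite (IH Hkl). ring. }
(* The form of each triangle is invariant under translations. *)
assert (Htot : forall t, In t T -> lsum (fun w => tri_form P u w t) (seq 1 (N + 3)) = RtoC 0).
{ intros t Ht.
  assert (Hv : lsum (tri_vec P t) (seq 1 (N + 3)) = RtoC 0).
  { assert (L : forall l, lsum (tri_vec P t) l =
      Cminus (rscale (rsum (vel2 t) l) (edge1 P t)) (rscale (rsum (vel1 t) l) (edge2 P t))).
    { intros l. induction l as [|a l IH]; simpl;
      [|rewrite IH]; unfold tri_vec, rscale, Cminus, Cplus, Copp, RtoC; simpl; f_equal; ring. }
    assert (V : forall a b l, rsum (fun w => kron a w - kron b w) l
      = rsum (kron a) l - rsum (kron b) l).
    { intros a b l. induction l as [|c l IH]; simpl; [ring|rewrite IH; ring]. }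
    rewrite L. destruct HT as [(HT' & _) _]. specialize (HT' t Ht).
    destruct t as [[a b] c]. destruct HT' as (Ia & Ib & Ic & _).
    unfold vel1, vel2. rewrite !V.
    rewrite !Hkron; try apply seq_NoDup; try (apply in_seq; unfold idx in *; lia).
    unfold rscale, Cminus, Cplus, Copp, RtoC; simpl. f_equal; ring. }
  transitivity (Cmult (Cmult (RtoC (tri_weight P t)) (tri_vec P t u))
    (lsum (fun w => Cconj (tri_vec P t w)) (seq 1 (N + 3)))).
  - rewrite <- lsum_mult. apply lsum_ext. intros w _. rewrite tri_form_eq. ring.
  - rewrite lsum_conj, Hv. unfold Cconj, Cmult, RtoC; simpl. f_equal; ring. }
assert (E : Cplus (lsum (tri_form P u u) T)
  (lsum (fun w => if Nat.eqb w u then RtoC 0 else edge_form N P u w) (seq 1 (N + 3))) = RtoC 0).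
{ transitivity (lsum (fun w => lsum (tri_form P u w) T) (seq 1 (N + 3))).
  - rewrite (Hsplit (fun w => lsum (tri_form P u w) T)) by (auto; apply seq_NoDup).
    f_equal. apply lsum_ext. intros w Hw. destruct (Nat.eqb_spec w u); [reflexivity|].
    symmetry. apply (edge_sum N z1 z2 z3 z T); auto.
    apply in_seq in Hw. unfold idx. lia.
  - rewrite lsum_swap. now apply lsum_0. }
assert (F : forall a b : CC, Cplus a b = RtoC 0 -> a = Copp b).
{ intros a b H. transitivity (Cplus (Cplus a b) (Copp b)); [ring|]. rewrite H. ring. }
now apply F.
Qed.

(** Built from the points alone, so it has a value without choice where several Delaunay
    triangulations exist. *)
Definition kaehler_form (N : nat) (P : nat -> CC) (u v : nat) : CC :=
  if Nat.eqb u v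
  then Copp (lsum (fun w => if Nat.eqb w u then RtoC 0 else edge_form N P u w) (seq 1 (N + 3)))
  else edge_form N P u v.

Lemma kaehler_form_lsum (N : nat) (z1 z2 z3 : CC) (z : nat -> CC) (T : list tri) (u v : nat) :
  admissible N z1 z2 z3 z -> is_delaunay N z1 z2 z3 z T -> cidx N u -> cidx N v ->
  kaehler_form N (pts z1 z2 z3 z) u v = lsum (tri_form (pts z1 z2 z3 z) u v) T.
Proof.
intros Hadm HT Hu Hv. unfold kaehler_form. destruct (Nat.eqb_spec u v) as [<-|n].
- symmetry. now apply edge_form_diag.
- symmetry. apply (edge_sum N z1 z2 z3 z T); auto. unfold cidx, idx in *; lia.
Qed.

Lemma contC_kaehler_form (N : nat) (z1 z2 z3 : CC) (z : nat -> CC) (u v : nat) :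
  orient z1 z2 z3 <> 0 -> admissible N z1 z2 z3 z -> cidx N u -> cidx N v ->
  contC N z (fun y => kaehler_form N (pts z1 z2 z3 y) u v).
Proof.
intros Hnc Hadm Hu Hv. unfold kaehler_form. destruct (Nat.eqb_spec u v) as [<-|n].
- apply contC_opp.
  apply (contC_lsum N z (fun y w => if Nat.eqb w u then RtoC 0
                                    else edge_form N (pts z1 z2 z3 y) u w)).
  intros w Hw. destruct (Nat.eqb_spec w u); [apply contC_const|].
  apply contC_edge_form; auto. apply in_seq in Hw. unfold idx; lia.
- apply contC_edge_form; auto. unfold cidx, idx in *; lia.
Qed.

Lemma delaunay_ccw (N : nat) (z1 z2 z3 : CC) (z : nat -> CC) (T : list tri) :
  is_delaunay N z1 z2 z3 z T -> forall t, In t T -> ccw (pts z1 z2 z3 z) t.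
Proof.
intros [(H & _) _] t Ht. specialize (H t Ht). destruct t as [[a b] c]. apply H.
Qed.

Theorem theorem5 (N : nat) (z1 z2 z3 : CC) (hnc : orient z1 z2 z3 <> 0) :
  (* positivity of D at configurations with unique Delaunay triangulation *)
  (forall (z : nat -> CC) (T : list tri),
     admissible N z1 z2 z3 z -> unique_delaunay N z1 z2 z3 z T ->
     forall xi : nat -> CC,
       Im (hermitian_value N (Dform z1 z2 z3 T z) xi) = 0 /\
       0 <= Re (hermitian_value N (Dform z1 z2 z3 T z) xi)) /\
  (* continuous extension to all admissible configurations *)
  (exists Dt : (nat -> CC) -> nat -> nat -> CC,
     (forall (z : nat -> CC) (T : list tri),
        admissible N z1 z2 z3 z -> unique_delaunay N z1 z2 z3 z T ->
        forall u v, cidx N u -> cidx N v -> Dt z u v = Dform z1 z2 z3 T z u v) /\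
     (forall u v, cidx N u -> cidx N v ->
      forall z, admissible N z1 z2 z3 z ->
      forall eps : R, 0 < eps -> exists delta : R, 0 < delta /\
        forall z', admissible N z1 z2 z3 z' ->
          (forall k, cidx N k -> Cmod (Cminus (z' k) (z k)) < delta) ->
          Cmod (Cminus (Dt z' u v) (Dt z u v)) < eps)).
Proof.
split.
- intros z T Hadm [HT _] xi. assert (Hccw := delaunay_ccw _ _ _ _ _ _ HT).
  apply (hermitian_value_nonneg N _ (pts z1 z2 z3 z) T xi Hccw).
  intros u v Hu Hv. now apply Dform_lsum.
- exists (fun z => kaehler_form N (pts z1 z2 z3 z)). split.
  + intros z T Hadm [HT _] u v Hu Hv. assert (Hccw := delaunay_ccw _ _ _ _ _ _ HT).
    rewrite Dform_lsum; try assumption; try (unfold cidx in *; lia).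
    now apply kaehler_form_lsum.
  + intros u v Hu Hv z Hadm eps He.
    destruct (contC_delta N z _ (contC_kaehler_form N z1 z2 z3 z u v hnc Hadm Hu Hv) eps He)
      as (d & Hd & H).
    exists d. split; [exact Hd|]. intros z' _ Hz'. exact (H z' Hz').
Qed.
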